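(* The category $\mathbf{AriLPries}$ of arithmetic L-spaces and coherent L-morphisms is equivalent to the category $\mathbf{StKBSp}$ of stably compactly based spaces and coherent maps, and dually equivalent to the category $\mathbf{AriFrm}$ of arithmetic frames and coherent frame homomorphisms.
   Context: A frame is a complete lattice satisfying $a\wedge\bigvee S=\bigvee\{a\wedge s\mid s\in S\}$; frame homomorphisms preserve finite meets and arbitrary joins. In a frame $L$, $a\ll b$ means whenever $b\le\bigvee S$ there is finite $T\subseteq S$ with $a\le\bigvee T$; $a$ is compact if $a\ll a$; $K(L)$ is the set of compact elements. $L$ is arithmetic if every element is the join of the compact elements below it and $\ll$ is stable ($a\ll b,c$ implies $a\ll b\wedge c$). A frame homomorphism is coherent if it maps compact elements to compact elements. A Priestley space is a Stone space $X$ with a partial order such that clopen upsets separate points. An L-space is a Priestley space in which the downset of each clopen set is clopen and the closure of each open upset is open. ${\sf ClopUp}(X)$ is the set of clopen upsets; $\mathrm{cl}$ denotes closure. An L-morphism is a continuous order-preserving map $f:X\to X'$ between L-spaces with $f^{-1}(\mathrm{cl}\,U)=\mathrm{cl}\,f^{-1}(U)$ for every open upset $U$ of $X'$. The spatial part of $X$ is $Y=\{y\in X\mid{\downarrow}y\text{ clopen}\}$. A Scott upset is a closed upset $F$ with $\min F\subseteq Y$; ${\sf ClopSUp}(X)$ is the set of clopen Scott upsets. For $U,V\in{\sf ClopUp}(X)$, $V\ll U$ means that for every open upset $W$, $U\subseteq\mathrm{cl}\,W$ implies $V\subseteq W$; $\ker U=\bigcup\{V\in{\sf ClopUp}(X)\mid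 V\ll U\}$; $\mathrm{core}\,U=\bigcup\{V\in{\sf ClopSUp}(X)\mid V\subseteq U\}$. An arithmetic L-space is an L-space in which $\mathrm{core}\,U$ is dense in $U$ for each $U\in{\sf ClopUp}(X)$ and $\ker(U\cap V)=\ker U\cap\ker V$ for all $U,V\in{\sf ClopUp}(X)$. An L-morphism $f:X_1\to X_2$ is coherent if $f^{-1}(\mathrm{core}\,U)\subseteq\mathrm{core}\,f^{-1}(U)$ for all $U\in{\sf ClopUp}(X_2)$. A topological space is stably compactly based if it is sober, has a basis of compact open sets, and the intersection of two compact open sets is compact. A continuous map is coherent if preimages of compact open sets are compact. *)

(* Defs.v *)
From HB Require Import structures.
From mathcomp Require Import all_boot all_order.
From mathcomp Require Import boolp classical_sets functions cardinality.
From mathcomp Require Import topology.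
Set Implicit Arguments.
Unset Strict Implicit.
Unset Printing Implicit Defensive.
Local Open Scope classical_set_scope.

(* A concrete category is given by a type of objects [O], a carrier     *)
(* [car : O -> Type] and a predicate [H a b f] saying which functions   *)
(* [f : car a -> car b] are morphisms; identity and composition are the *)
(* usual ones on functions, and morphisms are equal iff they are equal  *)
(* as functions.                                                        *)

Definition cat_iso (O : Type) (car : O -> Type)
  (H : forall a b : O, (car a -> car b) -> Prop) (a b : O) : Prop :=
  exists (f : car a -> car b) (g : car b -> car a),
    [/\ H a b f, H b a g, cancel f g & cancel g f].

Definition cat_equivalent (O1 : Type) (car1 : O1 -> Type)
  (H1 : forall a b : O1, (car1 a -> car1 b) -> Prop)
  (O2 : Type) (car2 : O2 -> Type)
  (H2 : forall a b : O2, (car2 a -> car2 b) -> Prop) : Prop :=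
  exists (Fo : O1 -> O2)
         (Fh : forall a b (f : car1 a -> car1 b), H1 a b f ->
                 car2 (Fo a) -> car2 (Fo b)),
      (forall a b f (hf : H1 a b f), H2 _ _ (Fh a b f hf)) /\
      (forall a (hf : H1 a a id), Fh a a id hf =1 id) /\
      (forall a b c (f : car1 a -> car1 b) (g : car1 b -> car1 c)
         (hf : H1 a b f) (hg : H1 b c g) (hgf : H1 a c (g \o f)),
         Fh a c (g \o f) hgf =1 Fh b c g hg \o Fh a b f hf) /\
      (forall a b (f g : car1 a -> car1 b) (hf : H1 a b f) (hg : H1 a b g),
         Fh a b f hf =1 Fh a b g hg -> f =1 g) /\
      (forall a b (h : car2 (Fo a) -> car2 (Fo b)), H2 _ _ h ->
         exists f (hf : H1 a b f), Fh a b f hf =1 h) /\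
      (forall d, exists c, cat_iso H2 (Fo c) d).

Definition cat_dually_equivalent (O1 : Type) (car1 : O1 -> Type)
  (H1 : forall a b : O1, (car1 a -> car1 b) -> Prop)
  (O2 : Type) (car2 : O2 -> Type)
  (H2 : forall a b : O2, (car2 a -> car2 b) -> Prop) : Prop :=
  exists (Fo : O1 -> O2)
         (Fh : forall a b (f : car1 a -> car1 b), H1 a b f ->
                 car2 (Fo b) -> car2 (Fo a)),
      (forall a b f (hf : H1 a b f), H2 _ _ (Fh a b f hf)) /\
      (forall a (hf : H1 a a id), Fh a a id hf =1 id) /\
      (forall a b c (f : car1 a -> car1 b) (g : car1 b -> car1 c)
         (hf : H1 a b f) (hg : H1 b c g) (hgf : H1 a c (g \o f)),
         Fh a c (g \o f) hgf =1 Fh a b f hf \o Fh b c g hg) /\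
      (forall a b (f g : car1 a -> car1 b) (hf : H1 a b f) (hg : H1 a b g),
         Fh a b f hf =1 Fh a b g hg -> f =1 g) /\
      (forall a b (h : car2 (Fo b) -> car2 (Fo a)), H2 _ _ h ->
         exists f (hf : H1 a b f), Fh a b f hf =1 h) /\
      (forall d, exists c, cat_iso H2 d (Fo c)).

Record frame := Frame {
  fcar :> Type;
  fle : fcar -> fcar -> Prop;
  fsup : set fcar -> fcar;
  fmeet : fcar -> fcar -> fcar;
  fle_refl : forall a, fle a a;
  fle_antisym : forall a b, fle a b -> fle b a -> a = b;
  fle_trans : forall a b c, fle a b -> fle b c -> fle a c;
  fsup_ub : forall S a, S a -> fle a (fsup S);
  fsup_least : forall S b, (forall a, S a -> fle a b) -> fle (fsup S) b;
  fmeet_lbl : forall a b, fle (fmeet a b) a;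
  fmeet_lbr : forall a b, fle (fmeet a b) b;
  fmeet_greatest : forall a b c, fle c a -> fle c b -> fle c (fmeet a b);
  frame_distr : forall a S, fmeet a (fsup S) = fsup [set fmeet a s | s in S]
}.

Definition ftop (L : frame) : L := fsup [set: L].

Definition frame_hom (L M : frame) (h : L -> M) : Prop :=
  [/\ h (ftop L) = ftop M,
      (forall a b, h (fmeet a b) = fmeet (h a) (h b)) &
      (forall S : set L, h (fsup S) = fsup (h @` S))].

Definition way_below (L : frame) (a b : L) : Prop :=
  forall S : set L, fle b (fsup S) ->
    exists T : set L, [/\ finite_set T, T `<=` S & fle a (fsup T)].

Definition fcompact (L : frame) (a : L) : Prop := way_below a a.

Definition arithmetic_frame (L : frame) : Prop :=
  (forall a : L, a = fsup [set k | fcompact k /\ fle k a]) /\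
  (forall a b c : L, way_below a b -> way_below a c -> way_below a (fmeet b c)).

Definition coherent_frame_hom (L M : frame) (h : L -> M) : Prop :=
  forall a : L, fcompact a -> fcompact (h a).

Section OrderedSpace.
Variables (T : topologicalType) (le : T -> T -> Prop).

Definition upset (A : set T) : Prop := forall x y, A x -> le x y -> A y.
Definition downset_of (A : set T) : set T := [set x | exists2 a, A a & le x a].

Definition stone_space : Prop :=
  [/\ compact [set: T], hausdorff_space T &
      (forall U : set T, open U -> forall x, U x ->
         exists V : set T, [/\ clopen V, V x & V `<=` U])].

Definition partial_order : Prop :=
  [/\ (forall x, le x x), (forall x y, le x y -> le y x -> x = y) &
      (forall x y z, le x y -> le y z -> le x z)].

Definition priestley_space : Prop :=
  [/\ stone_space, partial_order &
      forall x y, ~ le x y ->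
        exists U : set T, [/\ clopen U, upset U, U x & ~ U y]].

Definition L_space : Prop :=
  [/\ priestley_space,
      (forall U : set T, clopen U -> clopen (downset_of U)) &
      (forall U : set T, open U -> upset U -> open (closure U))].

Definition clopen_upset (U : set T) : Prop := clopen U /\ upset U.

Definition spatial_part : set T := [set y | clopen (downset_of [set y])].

Definition minimals (F : set T) : set T :=
  [set x | F x /\ forall y, F y -> le y x -> y = x].

Definition scott_upset (F : set T) : Prop :=
  [/\ closed F, upset F & minimals F `<=` spatial_part].

Definition clopen_scott_upset (U : set T) : Prop := clopen U /\ scott_upset U.

Definition Lway_below (V U : set T) : Prop :=
  forall W : set T, open W -> upset W -> U `<=` closure W -> V `<=` W.

Definition ker (U : set T) : set T :=
  [set x | exists V, [/\ clopen_upset V, Lway_below V U & V x]].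

Definition core (U : set T) : set T :=
  [set x | exists V, [/\ clopen_scott_upset V, V `<=` U & V x]].

Definition arithmetic_L_space : Prop :=
  [/\ L_space,
      (forall U, clopen_upset U -> U `<=` closure (core U)) &
      (forall U V, clopen_upset U -> clopen_upset V ->
         ker (U `&` V) = ker U `&` ker V)].

End OrderedSpace.

Definition L_morphism (X1 X2 : topologicalType)
  (le1 : X1 -> X1 -> Prop) (le2 : X2 -> X2 -> Prop) (f : X1 -> X2) : Prop :=
  [/\ continuous f,
      (forall x y, le1 x y -> le2 (f x) (f y)) &
      (forall U : set X2, open U -> upset le2 U ->
         f @^-1` (closure U) = closure (f @^-1` U))].

Definition coherent_L_morphism (X1 X2 : topologicalType)
  (le1 : X1 -> X1 -> Prop) (le2 : X2 -> X2 -> Prop) (f : X1 -> X2) : Prop :=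
  L_morphism le1 le2 f /\
  (forall U : set X2, clopen_upset le2 U ->
     f @^-1` (core le2 U) `<=` core le1 (f @^-1` U)).

Section Spaces.
Variable T : topologicalType.

Definition irreducible_closed (C : set T) : Prop :=
  [/\ closed C, C !=set0 &
      forall A B : set T, closed A -> closed B -> C `<=` A `|` B ->
        C `<=` A \/ C `<=` B].

Definition sober : Prop :=
  forall C : set T, irreducible_closed C ->
    exists! x : T, C = closure [set x].

Definition compact_open (U : set T) : Prop := compact U /\ open U.

Definition stably_compactly_based : Prop :=
  [/\ sober,
      (forall U : set T, open U -> forall x, U x ->
         exists V : set T, [/\ compact_open V, V x & V `<=` U]) &
      (forall U V : set T, compact_open U -> compact_open V -> compact (U `&` V))].

End Spaces.

Definition coherent_map (X Y : topologicalType) (f : X -> Y) : Prop :=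
  continuous f /\
  (forall U : set Y, compact_open U -> compact (f @^-1` U)).

Record ariLSpace := AriLSpace {
  als_T :> topologicalType;
  als_le : als_T -> als_T -> Prop;
  als_ax : arithmetic_L_space als_le
}.
Definition AriLPries_hom (X Y : ariLSpace) (f : X -> Y) : Prop :=
  coherent_L_morphism (@als_le X) (@als_le Y) f.

Record skbSpace := SKBSpace {
  skb_T :> topologicalType;
  skb_ax : stably_compactly_based skb_T
}.
Definition StKBSp_hom (X Y : skbSpace) (f : X -> Y) : Prop :=
  coherent_map f.

Record ariFrame := AriFrame {
  af_F :> frame;
  af_ax : arithmetic_frame af_F
}.
Definition AriFrm_hom (L M : ariFrame) (h : L -> M) : Prop :=
  frame_hom h /\ coherent_frame_hom h.

Definition AriLPries_car (X : ariLSpace) : Type := als_T X.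
Definition StKBSp_car (X : skbSpace) : Type := skb_T X.
Definition AriFrm_car (L : ariFrame) : Type := fcar (af_F L).
Arguments cat_equivalent {O1} car1 H1 {O2} car2 H2.
Arguments cat_dually_equivalent {O1} car1 H1 {O2} car2 H2.

(* Main.v *)
(* Both AriLPries and StKBSp are dually equivalent to AriFrm, so the equivalence
   between them is obtained by composing one duality with a quasi-inverse of the
   other.

   Spaces: a sober space is recovered from its frame of opens as the space of
   completely prime filters. An arithmetic frame has enough of these, because
   the elements of a prime filter lying above one of its compact elements form a
   completely prime filter; compact elements of the frame are compact opens.

   L-spaces: an L-space is recovered from its frame of clopen upsets as the
   space of prime filters with the topology generated by the sets {F | a in F}
   and their complements. Joins are closures of unions, the way-below relation
   of the frame is the one defined through closures of open upsets, and the
   compact elements are the clopen Scott upsets. Hence density of the core says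
   that compact elements generate the frame, and
   [ker (U `&` V) = ker U `&` ker V] says that way-below is stable. *)
From HB Require Import structures.
From mathcomp Require Import all_boot all_order.
From mathcomp Require Import boolp classical_sets functions cardinality.
From mathcomp Require Import topology.
Require Import Defs.
Set Implicit Arguments.
Unset Strict Implicit.
Unset Printing Implicit Defensive.
Local Open Scope classical_set_scope.

(** The sets live over a bare [Type], so the enumeration by a sequence passes through the classical
    equality of [{classic T}]. *)
Lemma finite_set_ind (T : Type) (P : set T -> Prop) :
  P set0 -> (forall x A, finite_set A -> P A -> P (x |` A)) ->
  forall A, finite_set A -> P A.
Proof.
move=> P0 PU A /(@finite_seqP {classic T})[s ->].
elim: s => [|x s IH]; first by rewrite set_nil.
have -> : [set` x :: s] = x |` [set` s].
  apply/seteqP; split=> y /=.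
    by rewrite inE => /orP[/eqP->|?]; [left|right].
  by rewrite inE => -[->|->]; rewrite ?eqxx ?orbT.
by apply: PU => //; apply/(@finite_seqP {classic T}); exists s.
Qed.

(** * Compactness *)

Section Compactness.
Context {T : topologicalType}.
Implicit Types (A : set T) (S : set (set T)).

Definition finitely_covered A S :=
  exists S', [/\ finite_set S', S' `<=` S & A `<=` \bigcup_(U in S') U].

(** If no finite subfamily covers [A], the sets [A] minus a finite union generate a proper filter,
    and a cluster point of it in [A] can lie in no member of the cover. Conversely, if a filter has
    no cluster point in [A], the open sets whose complement is in the filter cover [A], and a finite
    subcover puts the empty set into the filter. *)
Lemma compact_finitely_covered A :
  compact A <->
  forall S, (forall U, S U -> open U) -> A `<=` \bigcup_(U in S) U ->
    finitely_covered A S.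
Proof.
split=> [cA S oS AS|cA F FF FA].
  apply: contrapT => nfin.
  pose F : set_system T := [set B | exists S', [/\ finite_set S', S' `<=` S &
    A `\` \bigcup_(U in S') U `<=` B]].
  have FF : ProperFilter F.
    apply: Build_ProperFilter_ex => [B [S' [fS' S'S AB]]|].
      have /existsNP[x /not_implyP[Ax nx]] : ~ (A `<=` \bigcup_(U in S') U).
        by move=> AS'; apply: nfin; exists S'.
      by exists x; apply: AB.
    split=> [|B C [SB [fB SBS AB]] [SC [fC SCS AC]]|B C BC [S' [f S'S AB]]].
    - by exists set0; split=> //; exact: finite_set0.
    - exists (SB `|` SC); split; first by rewrite finite_setU.
        by move=> U [/SBS|/SCS].
      rewrite bigcup_setU => x [Ax nx]; split.
        by apply: AB; split=> // ?; apply: nx; left.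
      by apply: AC; split=> // ?; apply: nx; right.
    - by exists S'; split=> //; exact: subset_trans BC.
  have [|p [Ap clp]] := cA F FF.
    by exists set0; split=> [|//|x []//]; exact: finite_set0.
  have [U SU Up] := AS _ Ap.
  have [||x [[_ nUx] Ux]] := clp (A `\` U) U.
  - exists [set U]; split; [exact: finite_set1|by move=> _ ->|].
    by move=> x [Ax nx]; split=> // Ux; apply: nx; exists U.
  - by apply: open_nbhs_nbhs; split=> //; exact: oS.
  - by [].
apply: contrapT => ncl.
pose S : set (set T) := [set U | open U /\ F (~` U)].
have [|p Ap|S' [fS' S'S AS']] := cA S; first by move=> U [].
  have : ~ cluster F p by move=> clp; apply: ncl; exists p.
  move=> /existsNP[B /existsNP[C /not_implyP[FB /not_implyP[pC BC]]]].
  move: pC; rewrite nbhsE => -[U [oU Up] UC].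
  exists U => //; split=> //; apply: filterS FB => x Bx Ux.
  by apply: BC; exists x; split=> //; exact: UC.
have FS' : F (~` \bigcup_(U in S') U).
  elim/finite_set_ind: S' / fS' S'S {AS'} => [_|U S' fS' IH S'S].
    by rewrite bigcup_set0 setC0; exact: filterT.
  rewrite bigcup_setU1 setCU; apply: filterI.
    by have [|] := S'S U; first by left.
  by apply: IH => V SV; apply: S'S; right.
have : F set0.
  by apply: filterS (filterI FA FS') => x [/AS' + nx].
exact: filter_not_empty.
Qed.

(** Most later compactness arguments choose a family closed under binary unions, so that a finite
    subcover collapses to one member; [S set0] handles the empty subcover. *)
Lemma compact_directed_cover A S :
  compact A -> (forall U, S U -> open U) -> S set0 ->
  (forall U V, S U -> S V -> S (U `|` V)) ->
  A `<=` \bigcup_(U in S) U -> exists2 U, S U & A `<=` U.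
Proof.
move=> /compact_finitely_covered cA oS S0 SU AS.
have [S' [fS' S'S AS']] := cA _ oS AS.
exists (\bigcup_(U in S') U) => //.
elim/finite_set_ind: S' / fS' S'S {AS'} => [_|U S' _ IH S'S].
  by rewrite bigcup_set0.
rewrite bigcup_setU1; apply: SU; first by apply: S'S; left.
by apply: IH => V ?; apply: S'S; right.
Qed.

End Compactness.

(** * Frames *)

Section FrameTheory.
Variable L : frame.
Implicit Types (a b c : L) (S : set L).

Definition fjoin a b : L := fsup [set a; b].
Definition fbot : L := fsup set0.

Lemma fle_top a : fle a (ftop L). Proof. exact: fsup_ub. Qed.
Lemma fbot_le a : fle fbot a. Proof. exact: fsup_least. Qed.
Lemma fle_joinl a b : fle a (fjoin a b). Proof. by apply: fsup_ub; left. Qed.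
Lemma fle_joinr a b : fle b (fjoin a b). Proof. by apply: fsup_ub; right. Qed.
Lemma fjoin_least a b c : fle a c -> fle b c -> fle (fjoin a b) c.
Proof. by move=> ac bc; apply: fsup_least => x [->|->]. Qed.

Lemma fsup_mono S S' : S `<=` S' -> fle (fsup S) (fsup S').
Proof. by move=> SS'; apply: fsup_least => a /SS'; exact: fsup_ub. Qed.

Lemma fle_meetC a b : fle (fmeet a b) (fmeet b a).
Proof. by apply: fmeet_greatest; [exact: fmeet_lbr|exact: fmeet_lbl]. Qed.

Lemma fmeetC a b : fmeet a b = fmeet b a.
Proof. by apply: fle_antisym; exact: fle_meetC. Qed.

Lemma fmeet_mono a b c d : fle a b -> fle c d -> fle (fmeet a c) (fmeet b d).
Proof.
move=> ab cd; apply: fmeet_greatest.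
  exact: fle_trans (fmeet_lbl a c) ab.
exact: fle_trans (fmeet_lbr a c) cd.
Qed.

Lemma fmeet_sup_le a S c :
  (forall s, S s -> fle (fmeet a s) c) -> fle (fmeet a (fsup S)) c.
Proof.
by move=> Sc; rewrite frame_distr; apply: fsup_least => _ [s Ss <-]; exact: Sc.
Qed.

Lemma fmeet_join_le a b c d :
  fle (fmeet a b) d -> fle (fmeet a c) d -> fle (fmeet a (fjoin b c)) d.
Proof. by move=> ? ?; apply: fmeet_sup_le => _ [->|->]. Qed.

(** A finite join is an iterated binary join starting from the bottom. This is applied both to the
    compact elements and to the complement of a prime filter. *)
Lemma fsup_finite_closed (P : set L) S :
  P fbot -> (forall a b, P a -> P b -> P (fjoin a b)) ->
  finite_set S -> S `<=` P -> P (fsup S).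
Proof.
move=> P0 PU; elim/finite_set_ind => // a A _ IH AP.
have -> : fsup (a |` A) = fjoin a (fsup A).
  apply: fle_antisym.
    apply: fsup_least => b [->|Ab]; first exact: fle_joinl.
    by apply: fle_trans (fle_joinr _ _); exact: fsup_ub.
  apply: fjoin_least; first by apply: fsup_ub; left.
  by apply: fsup_mono => b; right.
apply: PU; first by apply: AP; left.
by apply: IH => b Ab; apply: AP; right.
Qed.

Lemma way_below_le a b c d :
  fle a b -> way_below b c -> fle c d -> way_below a d.
Proof.
move=> ab bc cd S dS; have [|T [fT TS bT]] := bc S; first exact: fle_trans dS.
by exists T; split=> //; exact: fle_trans bT.
Qed.

Lemma way_below_join a b c :
  way_below a c -> way_below b c -> way_below (fjoin a b) c.
Proof.
move=> ac bc S cS.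
have [T [fT TS aT]] := ac S cS; have [T' [fT' T'S bT']] := bc S cS.
exists (T `|` T'); split; first by rewrite finite_setU.
  by move=> x [/TS|/T'S].
apply: fjoin_least.
  by apply: fle_trans aT _; apply: fsup_mono => x; left.
by apply: fle_trans bT' _; apply: fsup_mono => x; right.
Qed.

Lemma way_below_bot c : way_below fbot c.
Proof.
move=> S _; exists set0; split=> [|//|]; first exact: finite_set0.
exact: fbot_le.
Qed.

Lemma fcompact_join a b : fcompact a -> fcompact b -> fcompact (fjoin a b).
Proof.
move=> ca cb; apply: way_below_join.
  exact: way_below_le (fle_refl _) ca (fle_joinl _ _).
exact: way_below_le (fle_refl _) cb (fle_joinr _ _).
Qed.

Lemma fcompact_finite_sup S :
  finite_set S -> S `<=` @fcompact L -> fcompact (fsup S).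
Proof.
apply: fsup_finite_closed; first exact: way_below_bot.
by move=> *; exact: fcompact_join.
Qed.

(** Interpolation: the finite subset of [S] provided by way-below has a compact join. *)
Lemma way_below_sup_compact a S :
  S `<=` @fcompact L -> way_below a (fsup S) ->
  exists k, [/\ fcompact k, fle a k & fle k (fsup S)].
Proof.
move=> Sc /(_ S (fle_refl _))[T [fT TS aT]]; exists (fsup T); split=> //.
  by apply: fcompact_finite_sup => // x /TS/Sc.
exact: fsup_mono.
Qed.

(** When compact elements generate, [a] way below [b] and [c] interpolates as [a <= k <= b] and
    [a <= l <= c] with [k], [l] compact. If the meet of [k] and [l] is compact, it interpolates
    between [a] and the meet of [b] and [c]. *)
Lemma arithmetic_frameP :
  arithmetic_frame L <->
  (forall a, a = fsup [set k | fcompact k /\ fle k a]) /\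
  (forall a b, fcompact a -> fcompact b -> fcompact (fmeet a b)).
Proof.
split=> -[alg st]; split=> //.
  move=> a b ca cb; apply: st.
    exact: way_below_le (fmeet_lbl _ _) ca (fle_refl _).
  exact: way_below_le (fmeet_lbr _ _) cb (fle_refl _).
move=> a b c ab ac.
have comp x : [set k | fcompact k /\ fle k x] `<=` @fcompact L by move=> k [].
move: ab ac; rewrite {1}(alg b) {1}(alg c).
move=> /(way_below_sup_compact (comp b))[k [ck ak]]; rewrite -alg => kb.
move=> /(way_below_sup_compact (comp c))[l [cl al]]; rewrite -alg => lc.
apply: way_below_le (st _ _ ck cl) (fmeet_mono kb lc).
exact: fmeet_greatest.
Qed.

End FrameTheory.

(** * Transport along order isomorphisms of frames *)

Section OrderIsomorphism.
Variables (L M : frame) (f : L -> M) (g : M -> L).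
Hypotheses (fK : cancel f g) (gK : cancel g f).
Hypotheses (fle_f : forall a b, fle a b -> fle (f a) (f b))
           (fle_g : forall a b, fle a b -> fle (g a) (g b)).

Lemma order_iso_sup (S : set L) : f (fsup S) = fsup (f @` S).
Proof.
apply: fle_antisym; last first.
  by apply: fsup_least => _ [a Sa <-]; apply: fle_f; exact: fsup_ub.
rewrite -[X in fle _ X]gK; apply: fle_f; apply: fsup_least => a Sa.
by rewrite -[a]fK; apply: fle_g; apply: fsup_ub; exists a.
Qed.

Lemma order_iso_frame_hom : frame_hom f.
Proof.
split=> [|a b|S]; last exact: order_iso_sup.
  apply: fle_antisym; first exact: fle_top.
  by rewrite -[X in fle X _]gK; apply: fle_f; exact: fle_top.
apply: fle_antisym.
  by apply: fmeet_greatest; apply: fle_f; [exact: fmeet_lbl|exact: fmeet_lbr].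
rewrite -[X in fle X _]gK; apply: fle_f; apply: fmeet_greatest.
  by rewrite -[a in X in fle _ X]fK; apply: fle_g; exact: fmeet_lbl.
by rewrite -[b in X in fle _ X]fK; apply: fle_g; exact: fmeet_lbr.
Qed.

End OrderIsomorphism.

Lemma order_iso_coherent (L M : frame) (f : L -> M) (g : M -> L) :
  cancel f g -> cancel g f ->
  (forall a b, fle a b -> fle (f a) (f b)) ->
  (forall a b, fle a b -> fle (g a) (g b)) -> coherent_frame_hom f.
Proof.
move=> fK gK fle_f fle_g a ca S faS.
have [|T [fT TS aT]] := ca (g @` S).
  by rewrite -(order_iso_sup gK fK)// -[a]fK; exact: fle_g.
exists (f @` T); split; first exact: finite_image.
  by move=> _ [x /TS[s Ss <-] <-]; rewrite gK.
by rewrite -(order_iso_sup fK gK)//; exact: fle_f.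
Qed.

Lemma order_iso_arithmetic (L M : frame) (f : L -> M) (g : M -> L) :
  cancel f g -> cancel g f ->
  (forall a b, fle a b -> fle (f a) (f b)) ->
  (forall a b, fle a b -> fle (g a) (g b)) ->
  arithmetic_frame L -> arithmetic_frame M.
Proof.
move=> fK gK fle_f fle_g /arithmetic_frameP[alg st].
apply/arithmetic_frameP.
have cf := order_iso_coherent fK gK fle_f fle_g.
have cg := order_iso_coherent gK fK fle_g fle_f.
split=> [a|a b ca cb].
  rewrite -[LHS]gK [in LHS](alg (g a)) (order_iso_sup fK gK)//; congr fsup.
  apply/seteqP; split=> [_ [k [ck kga] <-]|k [ck ka]].
    by split; [exact: cf|rewrite -[a]gK; exact: fle_f].
  exists (g k); last exact: gK.
  by split; [exact: cg|exact: fle_g].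
have [_ fM _] := order_iso_frame_hom fK gK fle_f fle_g.
by rewrite -[a]gK -[b]gK -fM; apply/cf/st; exact: cg.
Qed.

(** * Frames of subsets *)

Section SetFrame.
Variables (X : Type) (P : set (set X)) (cl : set X -> set X).

(** One construction serves two frames: open sets, with [cl] the identity, and clopen upsets, with
    [cl] the topological closure. Joins are [cl] of unions; [sf_distr] asks only for the nontrivial
    inclusion of the frame law. *)
Record set_frame_axioms : Prop := SetFrameAxioms {
  sf_meet : forall U V, P U -> P V -> P (U `&` V);
  sf_sup : forall I (S : set I) (F : I -> set X),
    (forall i, S i -> P (F i)) -> P (cl (\bigcup_(i in S) F i));
  sf_sub : forall A, A `<=` cl A;
  sf_least : forall A U, P U -> A `<=` U -> cl A `<=` U;
  sf_distr : forall I (S : set I) (F : I -> set X) U,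
    P U -> (forall i, S i -> P (F i)) ->
    U `&` cl (\bigcup_(i in S) F i) `<=` cl (\bigcup_(i in S) (U `&` F i))
}.

Hypothesis ax : set_frame_axioms.

Let elt := {U : set X | P U}.

Lemma sval_eq (U V : elt) : sval U = sval V -> U = V.
Proof. by case: U V => [U pU] [V pV] /= E; exact: eq_exist. Qed.

Let sup_elt (S : set elt) : elt :=
  exist _ _ (sf_sup ax (fun (U : elt) (_ : S U) => proj2_sig U)).
Let meet_elt (U V : elt) : elt := exist _ _ (sf_meet ax (svalP U) (svalP V)).

Fact sup_elt_ub (S : set elt) U : S U -> sval U `<=` sval (sup_elt S).
Proof. by move=> SU x Ux; apply: (sf_sub ax); exists U. Qed.

Fact sup_elt_least (S : set elt) (V : elt) :
  (forall U, S U -> sval U `<=` sval V) -> sval (sup_elt S) `<=` sval V.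
Proof.
by move=> SV; apply: (sf_least ax (svalP V)) => x [U SU]; exact: SV.
Qed.

Fact elt_distr (U : elt) (S : set elt) :
  meet_elt U (sup_elt S) = sup_elt [set meet_elt U V | V in S].
Proof.
apply/sval_eq/seteqP; split=> x /=; last first.
  apply: (sf_least ax (svalP (meet_elt U (sup_elt S)))).
  move=> {}x [_ [V SV <-] [Ux Vx]]; split=> //.
  by apply: (sf_sub ax); exists V.
move=> /(sf_distr ax (svalP U) (fun V _ => proj2_sig V)).
apply: (sf_least ax (svalP (sup_elt _))).
move=> {}x [V SV UVx]; apply: (sf_sub ax).
by exists (meet_elt U V) => //; exists V.
Qed.

Definition set_frame : frame := @Frame elt
  (fun U V => sval U `<=` sval V) sup_elt meet_elt
  (fun U => @subset_refl X (sval U))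
  (fun U V UV VU => sval_eq (proj2 (seteqP _ _) (conj UV VU)))
  (fun U V W => @subset_trans X (sval V) (sval U) (sval W))
  sup_elt_ub sup_elt_least
  (fun U V => @subIsetl X (sval U) (sval V))
  (fun U V => @subIsetr X (sval U) (sval V))
  (fun U V W WU WV x Wx => conj (WU x Wx) (WV x Wx))
  elt_distr.

Definition elt_of U (pU : P U) : set_frame := exist _ U pU.

Lemma set_frame_leP (U V : set_frame) : fle U V <-> sval U `<=` sval V.
Proof. by []. Qed.

(** Families in the subset type are traded for families of plain subsets, the form in which
    topological compactness applies. Finiteness survives the passage back because [sval] is
    injective. *)
Lemma set_frame_way_belowP (U V : set_frame) :
  way_below U V <->
  forall S, S `<=` P -> sval V `<=` cl (\bigcup_(W in S) W) ->
    exists T, [/\ finite_set T, T `<=` S &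
      sval U `<=` cl (\bigcup_(W in T) W)].
Proof.
split=> [UV S SP VS|UV S VS].
  have [|T [fT TS UT]] := UV [set W : set_frame | S (sval W)].
    apply: subset_trans VS _ => x.
    apply: (sf_least ax (svalP (sup_elt _))).
    by move=> {}x [W SW Wx]; apply: (sf_sub ax); exists (elt_of (SP W SW)).
  exists [set sval W | W in T]; split; first exact: finite_image.
    by move=> _ [W /TS ? <-].
  by rewrite bigcup_image.
have [||T [fT TS UT]] := UV [set sval W | W in S].
- by move=> _ [W _ <-]; exact: svalP.
- by rewrite bigcup_image.
exists [set W | T (sval W)]; split.
- by apply: finite_preimage fT => W W' _ _; exact: sval_eq.
- by move=> W /TS[W' SW' /sval_eq <-].
- apply: subset_trans UT _.
  apply: (sf_least ax (svalP (sup_elt _))).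
  move=> x [W TW Wx]; apply: (sf_sub ax).
  by have [W' _ E] := TS _ TW; exists W'; rewrite /= E.
Qed.

End SetFrame.

(** * Open sets and points *)

(** Properness is included: for empty [S] the last clause keeps the bottom out of [F]. *)
Definition completely_prime (L : frame) (F : set L) : Prop :=
  [/\ F (ftop L),
      (forall a b, F a -> fle a b -> F b),
      (forall a b, F a -> F b -> F (fmeet a b)) &
      (forall S, F (fsup S) -> exists2 s, S s & F s)].

Section Opens.
Context {T : topologicalType}.

Fact opens_axioms : set_frame_axioms (@open T) id.
Proof.
split; first exact: openI.
- by move=> *; exact: bigcup_open.
- by move=> A x.
- by move=> A U _ AU x /AU.
- move=> I S F U _ _ x [Ux [i Si Fx]].
  by exists i.
Qed.

Definition opens : frame := set_frame opens_axioms.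

Lemma opens_compactP (U : opens) : fcompact U <-> compact (sval U).
Proof.
rewrite /fcompact; split.
  by move=> /set_frame_way_belowP ?; apply/compact_finitely_covered.
by move=> /compact_finitely_covered ?; apply/set_frame_way_belowP.
Qed.

Lemma stably_compactly_basedP :
  stably_compactly_based T <-> sober T /\ arithmetic_frame opens.
Proof.
split=> [[sob bas st]|[sob /arithmetic_frameP[alg st]]].
  split=> //; apply/arithmetic_frameP; split=> [U|U V].
    apply/sval_eq/seteqP; split=> x /=; last by case=> V [_ VU] /VU.
    move=> Ux; have [V [[cV oV] Vx VU]] := bas _ (svalP U) _ Ux.
    by exists (exist _ V oV) => //; split=> //; apply/opens_compactP.
  move=> /opens_compactP cU /opens_compactP cV; apply/opens_compactP.
  by apply: st; split=> //; exact: svalP.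
split=> // [U oU x Ux|U V [cU oU] [cV oV]].
  have := congr1 sval (alg (exist _ U oU)) => /= E.
  move: Ux; rewrite E => -[V [/opens_compactP cV VU] Vx].
  by exists (sval V); split=> //; [split=> //; exact: svalP|rewrite -E].
have /opens_compactP : fcompact (fmeet (exist _ U oU : opens) (exist _ V oV)).
  by apply: st; apply/opens_compactP.
by [].
Qed.

(** The right-hand side has the shape in which a closed set decides membership of [U] in a
    completely prime filter, so it can be rewritten once that closed set has a generic point. *)
Lemma closure1P (x : T) (U : set T) :
  open U -> U x <-> ~ (closure [set x] `<=` ~` U).
Proof.
move=> oU; split=> [Ux|nU].
  by move=> /(_ x); apply=> //; exact: subset_closure.
apply: contrapT => nUx; apply: nU.
have /closure_id -> : closed (~` U) by exact: open_closedC.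
by apply: closureS => _ ->.
Qed.

(** Points with the same open neighbourhoods have the same closure. The closure of a point is
    irreducible, and sobriety makes its generic point unique. *)
Lemma sober_eq (x y : T) : sober T ->
  (forall U, open U -> U x <-> U y) -> x = y.
Proof.
move=> sob xy.
have irr : irreducible_closed (closure [set x]).
  split; [exact: closed_closure|by exists x; exact: subset_closure|].
  move=> A B cA cB xAB.
  have {xAB} : (A `|` B) x by apply: xAB; exact: subset_closure.
  by case=> ?; [left|right]; [rewrite (proj1 (closure_id A) cA)
    |rewrite (proj1 (closure_id B) cB)]; apply: closureS => _ ->.
have [z [_ uz]] := sob _ irr.
rewrite -(uz x)// -(uz y)//; apply/seteqP; split=> t xt.
  apply: contrapT => nyt; have oy : open (~` closure [set y]).
    by apply: closed_openC; exact: closed_closure.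
  have [x' [-> /(xy _ oy)]] := xt _ (open_nbhs_nbhs (conj oy nyt)).
  by apply; exact: subset_closure.
apply: contrapT => nyt; have oy : open (~` closure [set x]).
  by apply: closed_openC; exact: closed_closure.
have [x' [-> /(xy _ oy)]] := xt _ (open_nbhs_nbhs (conj oy nyt)).
by apply; exact: subset_closure.
Qed.

(* The point of a completely prime filter [F] is the generic point of the
   complement of the largest open set outside [F]. *)
Lemma sober_point (F : set opens) : sober T -> completely_prime F ->
  exists x, forall U : opens, F U <-> sval U x.
Proof.
move=> sob [FT Fup FI Fsup].
pose C := ~` sval (fsup [set U | ~ F U] : opens).
have FC (U : opens) : F U <-> ~ (C `<=` ~` sval U).
  split=> [FU CU|nCU].
    have [|V nFV FV //] := Fsup [set U | ~ F U].
    apply: Fup FU _; apply/set_frame_leP => x Ux.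
    by apply: contrapT => nx; exact: CU Ux.
  apply: contrapT => nFU; apply: nCU => x Cx Ux; apply: Cx.
  by exists U.
have [|x [Cx _]] := sob C.
  split.
  - exact/open_closedC/svalP.
  - by have /FC/existsNP[x /not_implyP[Cx _]] := FT; exists x.
  (* If [C] lies in neither [A] nor [B], both complements belong to [F]; so does their meet, which
     must then meet [C]. *)
  - move=> A B cA cB CAB; apply: contrapT => /not_orP[nA nB].
    pose U : opens := exist _ (~` A) (closed_openC cA).
    pose V : opens := exist _ (~` B) (closed_openC cB).
    have FU : F U by apply/FC; rewrite /= setCK.
    have FV : F V by apply/FC; rewrite /= setCK.
    by have /FC := FI _ _ FU FV; apply => x /CAB[?|?] [].
exists x => U; rewrite FC Cx.
by rewrite -(closure1P x (svalP U)).
Qed.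

End Opens.
Arguments opens : clear implicits.

(** * Continuous maps as homomorphisms between frames of open sets *)

Section PreimageOfOpens.
Context {X Y : topologicalType}.

Definition opens_preimage (f : X -> Y) (cf : continuous f) (U : opens Y) :
    opens X :=
  exist _ _ (proj1 (continuousP f) cf _ (svalP U)).

Lemma opens_preimage_hom (f : X -> Y) (cf : continuous f) :
  frame_hom (opens_preimage cf).
Proof.
split.
- apply: fle_antisym; first exact: fle_top.
  by apply/set_frame_leP => x _; exists (exist _ setT openT).
- by move=> U V; exact: sval_eq.
- move=> S; apply: sval_eq; rewrite /= preimage_bigcup.
  by rewrite bigcup_image.
Qed.

(** For each [x] the open sets [U] with [x] in [h U] form a completely prime filter, and [f x] is
    its point. Then the preimage of [U] under [f] is [h U], which also gives continuity. *)
Lemma opens_preimage_full (h : opens Y -> opens X) : sober Y ->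
  frame_hom h ->
  exists f (cf : continuous f), opens_preimage cf =1 h.
Proof.
move=> sob [hT hI hS].
have hle (U V : opens Y) : fle U V -> fle (h U) (h V).
  move=> UV; have -> : U = fmeet U V.
    by apply/sval_eq/seteqP; split=> [x Ux|x []//]; split=> //; exact: UV.
  by rewrite hI; exact: fmeet_lbr.
have pt x : exists y, forall U : opens Y, sval (h U) x <-> sval U y.
  apply: (sober_point (F := [set U | sval (h U) x])) => //; split.
  - by rewrite /= hT; exists (exist _ setT openT).
  - by move=> U V hx UV; exact: hle UV _ hx.
  - by move=> U V ? ?; rewrite /= hI.
  - by move=> S; rewrite /= hS => -[_ [U SU <-] ?]; exists U.
have [f fP] := choice pt.
have cf : continuous f.
  apply/continuousP => U oU.
  have -> : f @^-1` U = sval (h (exist _ U oU)).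
    by apply/seteqP; split=> x /(fP x (exist _ U oU)).
  exact: svalP.
exists f, cf => U; apply/sval_eq/seteqP; split=> x /= /fP //.
Qed.

End PreimageOfOpens.

(** * Prime and completely prime filters of a frame *)

Definition prime_filter (L : frame) (F : set L) : Prop :=
  [/\ F (ftop L),
      (forall a b, F a -> fle a b -> F b),
      (forall a b, F a -> F b -> F (fmeet a b)),
      ~ F (fbot L) &
      (forall a b, F (fjoin a b) -> F a \/ F b)].

Section PrimeFilters.
Variable L : frame.

(** By Zorn's lemma there is a filter maximal among those containing [F] and avoiding [b]. It is
    prime by distributivity: if enlarging it by [c] and by [d] both produce [b], then so does
    enlarging it by their join. *)
Lemma prime_filter_exists (F : set L) (b : L) :
  F (ftop L) -> (forall a c, F a -> fle a c -> F c) ->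
  (forall a c, F a -> F c -> F (fmeet a c)) -> ~ F b ->
  exists P, [/\ prime_filter P, F `<=` P & ~ P b].
Proof.
move=> FT Fup FI nFb.
(* the last clause admits the empty union of an empty chain *)
pose Q : set (set L) := [set G | [/\ forall a c, G a -> fle a c -> G c,
  forall a c, G a -> G c -> G (fmeet a c), ~ G b & G !=set0 -> F `<=` G]].
have [|A [[Aup AI nAb A0] Amax]] := @Zorn_bigcup L Q.
  move=> C CQ Ctot; split.
  - move=> a c [G CG Ga] ac; exists G => //.
    by have [Gup _ _ _] := CQ _ CG; exact: Gup ac.
  - move=> a c [G CG Ga] [G' CG' G'c].
    have [GG'|G'G] := Ctot _ _ CG CG'.
      exists G' => //; have [_ GI _ _] := CQ _ CG'.
      by apply: GI => //; exact: GG'.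
    exists G => //; have [_ GI _ _] := CQ _ CG.
    by apply: GI => //; exact: G'G.
  - by move=> [G CG Gb]; have [_ _ + _] := CQ _ CG; exact.
  - move=> [a [G CG Ga]] x Fx; exists G => //.
    by have [_ _ _ GF] := CQ _ CG; apply: GF => //; exists a.
(* The empty set satisfies [Q]; maximality rules it out by comparison with [F]. *)
have FA : F `<=` A.
  apply: A0; apply: contrapT => A0; apply: (Amax F); last first.
    by split=> // _.
  split; first by move=> a Aa; case: A0; exists a.
  by move=> FA; apply: A0; exists (ftop L); exact: FA.
(* Maximality is applied to the filter generated by [A] and [c], which must contain [b]. *)
have ext c : ~ A c -> exists2 a, A a & fle (fmeet a c) b.
  move=> nAc; pose B : set L := [set z | exists2 a, A a & fle (fmeet a c) z].
  apply: contrapT => nBb; apply: (Amax B).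
    split=> [a Aa|BA]; first by exists a => //; exact: fmeet_lbl.
    by apply/nAc/BA; exists (ftop L); [exact: FA|exact: fmeet_lbr].
  split=> //.
  - by move=> z z' [a Aa az] zz'; exists a => //; exact: fle_trans zz'.
  - move=> z z' [a Aa az] [a' Aa' az'].
    exists (fmeet a a'); first exact: AI.
    apply: fmeet_greatest.
      by apply: fle_trans az; apply: fmeet_mono;
        [exact: fmeet_lbl|exact: fle_refl].
    by apply: fle_trans az'; apply: fmeet_mono;
      [exact: fmeet_lbr|exact: fle_refl].
  - move=> _ z /FA Az; exists z => //; exact: fmeet_lbl.
exists A; split=> //; split=> //; first exact: FA.
  by move=> Ab; apply: nAb; apply: Aup Ab _; exact: fbot_le.
move=> c d Acd; apply: contrapT => /not_orP[/ext[a Aa ac] /ext[a' Aa' ad]].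
apply: nAb; apply: (Aup (fmeet (fmeet a a') (fjoin c d))).
  exact: (AI _ _ (AI _ _ Aa Aa') Acd).
apply: fmeet_join_le.
  apply: fle_trans ac; apply: fmeet_mono; [exact: fmeet_lbl|exact: fle_refl].
apply: fle_trans ad; apply: fmeet_mono; [exact: fmeet_lbr|exact: fle_refl].
Qed.

Lemma prime_filter_separates (a b : L) : ~ fle a b ->
  exists P, [/\ prime_filter P, P a & ~ P b].
Proof.
move=> nab; have [||||P [pP aP nPb]] := @prime_filter_exists (fle a) b.
- exact: fle_top.
- exact: fle_trans.
- by move=> *; exact: fmeet_greatest.
- by [].
- by exists P; split=> //; apply: aP; exact: fle_refl.
Qed.

(** Some compact [k] below [a] is not below [b]. A prime filter [P] containing [k] but not [b] is
    shrunk to the elements above its compact members; [a] stays inside because of [k]. *)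
Lemma completely_prime_separates (a b : L) : arithmetic_frame L ->
  ~ fle a b -> exists F, [/\ completely_prime F, F a & ~ F b].
Proof.
move=> /arithmetic_frameP[alg st] nab.
have [k [ck ka nkb]] : exists k, [/\ fcompact k, fle k a & ~ fle k b].
  apply: contrapT => nk; apply: nab; rewrite (alg a).
  apply: fsup_least => k [ck ka]; apply: contrapT => nkb.
  by apply: nk; exists k.
have [P [[PT Pup PI P0 PU] Pk nPb]] := prime_filter_separates nkb.
exists [set x | exists k, [/\ fcompact k, fle k x & P k]]; split.
- split.
  + by exists k; split=> //; exact: fle_top.
  + move=> x y [l [cl lx Pl]] xy; exists l; split=> //; exact: fle_trans xy.
  + move=> x y [l [cl lx Pl]] [m [cm my Pm]]; exists (fmeet l m).
    by split; [exact: st|exact: fmeet_mono|exact: PI].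
  (* The compact [l] lies below a finite join of compact elements, each below a member of [S]. Since
     [P] is prime, one of them is in [P]. *)
  + move=> S [l [cl lS Pl]].
    pose K : set L := [set m | fcompact m /\ exists2 s, S s & fle m s].
    have [|T [fT TK lT]] := cl K.
      apply: fle_trans lS _; apply: fsup_least => s Ss.
      rewrite (alg s); apply: fsup_mono => m [cm ms].
      by split=> //; exists s.
    apply: contrapT => nS.
    suff : (~` P) (fsup T) by apply; exact: Pup lT.
    apply: fsup_finite_closed => //.
      by move=> x y nPx nPy /PU[].
    move=> m /TK[cm [s Ss ms]] Pm; apply: nS; exists s => //.
    by exists m; split.
- by exists k.
- by move=> [l [_ lb Pl]]; apply: nPb; exact: Pup lb.
Qed.

End PrimeFilters.

(** * The space of points of a frame *)

Definition points (L : frame) : Type := {F : set L | completely_prime F}.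

HB.instance Definition _ (L : frame) := gen_eqMixin (points L).
HB.instance Definition _ (L : frame) := gen_choiceMixin (points L).

Definition points_at (L : frame) (a : L) : set (points L) := [set x | sval x a].

Section PointsTopology.
Variable L : frame.

Lemma points_atT : points_at (ftop L) = setT.
Proof. by apply/seteqP; split=> // -[F []]. Qed.

Lemma points_atI (a b : L) :
  points_at (fmeet a b) = points_at a `&` points_at b.
Proof.
apply/seteqP; split=> -[F [FT Fup FI Fs]]; rewrite /points_at /=.
  move=> Fab; split; apply: Fup Fab _; [exact: fmeet_lbl|exact: fmeet_lbr].
by move=> [Fa Fb]; exact: FI.
Qed.

Lemma points_at_sup (S : set L) :
  points_at (fsup S) = \bigcup_(a in S) points_at a.
Proof.
apply/seteqP; split=> -[F [FT Fup FI Fs]]; rewrite /points_at /=.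
  by move=> /Fs[s Ss Fa]; exists s.
by move=> [s Ss Fa]; apply: Fup Fa _; exact: fsup_ub.
Qed.

(** No topology has to be generated: [points_at] turns finite meets and arbitrary joins into
    intersections and unions, so its range is already closed under them. *)
Definition points_open : set_system (points L) := range (@points_at L).

Fact points_openT : points_open setT.
Proof. by exists (ftop L) => //; exact: points_atT. Qed.

Fact points_openI : setI_closed points_open.
Proof.
by move=> _ _ [a _ <-] [b _ <-]; exists (fmeet a b) => //; exact: points_atI.
Qed.

Fact points_open_bigU (I : Type) (f : I -> set (points L)) :
  (forall i, points_open (f i)) -> points_open (\bigcup_i f i).
Proof.
move=> fo; have /choice[g gf] i : exists a, points_at a = f i.
  by have [a _ <-] := fo i; exists a.
exists (fsup (range g)) => //.
by rewrite points_at_sup bigcup_image; apply: eq_bigcupr => i _.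
Qed.

End PointsTopology.

HB.instance Definition _ (L : frame) :=
  isOpenTopological.Build (points L)
    (@points_openT L) (@points_openI L) (@points_open_bigU L).

Section PointsSpace.
Variable L : frame.
Hypothesis ariL : arithmetic_frame L.

Lemma points_at_open (a : L) : open (points_at a).
Proof. by exists a. Qed.

(** This is spatiality of [L]; it makes [to_opens] injective. *)
Lemma points_at_le (a b : L) : points_at a `<=` points_at b -> fle a b.
Proof.
move=> ab; apply: contrapT => /(completely_prime_separates ariL)[F [cF Fa]].
by apply; exact: (ab (exist _ F cF)).
Qed.

Definition to_opens (a : L) : opens (points L) :=
  exist _ _ (points_at_open a).
Definition of_opens (U : opens (points L)) : L :=
  fsup [set a | points_at a `<=` sval U].

Lemma to_opens_le a b : fle a b -> fle (to_opens a) (to_opens b).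
Proof.
move=> ab; apply/set_frame_leP => -[F [FT Fup FI Fs]]; rewrite /= /points_at /=.
by move=> Fa; exact: Fup ab.
Qed.

Lemma of_opens_le U V : fle U V -> fle (of_opens U) (of_opens V).
Proof.
by move=> UV; apply: fsup_mono => a; move=> /subset_trans; apply.
Qed.

Lemma to_opensK : cancel to_opens of_opens.
Proof.
move=> a; apply: fle_antisym; last exact: fsup_ub.
by apply: fsup_least => b; exact: points_at_le.
Qed.

Lemma of_opensK : cancel of_opens to_opens.
Proof.
move=> U; have [a _ aU] := svalP U.
have -> : U = to_opens a by exact: sval_eq.
by rewrite to_opensK.
Qed.

(** The generic point of [C] is the filter of those [a] whose open set meets [C]. Irreducibility of
    [C] is what closes this filter under meets. *)
Lemma points_sober : sober (points L).
Proof.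
move=> C [cC [x0 Cx0] irr].
pose F : set L := [set a | exists2 x, C x & points_at a x].
have cF : completely_prime F.
  split.
  - by exists x0; rewrite ?points_atT.
  - move=> a b [[G cG] CG Ga] ab; exists (exist _ G cG) => //.
    by have [_ Gup _ _] := cG; exact: Gup ab.
  - move=> a b [x Cx xa] [y Cy yb]; apply: contrapT => nF.
    have [|||Ca|Cb] := irr (~` points_at a) (~` points_at b).
    + exact/open_closedC/points_at_open.
    + exact/open_closedC/points_at_open.
    + rewrite -setCI -points_atI => z Cz abz.
      by apply: nF; exists z.
    + exact: Ca Cx xa.
    + exact: Cb Cy yb.
  - move=> S [x Cx]; rewrite points_at_sup => -[s Ss xs].
    by exists s => //; exists x.
(* By [CE] below, [C] consists of the filters contained in [F], which are the points in the closure
   of [y]. *)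
pose y : points L := exist _ F cF.
have CE z : C z <-> forall a, points_at a z -> F a.
  split=> [Cz a az|zF]; first by exists z.
  apply: contrapT => nCz; have [a _ aC] := closed_openC cC.
  have : points_at a z by rewrite aC.
  by move=> /zF[x Cx]; rewrite aC; apply.
exists y; split.
  apply/seteqP; split=> z.
    move=> /CE Cz B; rewrite nbhsE => -[U [[a _ <-] az] aB].
    by exists y; split=> //; apply: aB; exact: Cz.
  move=> yz; apply/CE => a az.
  have [|_ [-> //]] := yz (points_at a).
  by apply: open_nbhs_nbhs; split=> //; exact: points_at_open.
move=> [G cG] CG; apply: sval_eq => /=; apply/seteqP; split=> a.
  move=> [x]; rewrite CG => xG ax.
  have [|_ [-> //]] := xG (points_at a).
  by apply: open_nbhs_nbhs; split=> //; exact: points_at_open.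
move=> Ga; exists (exist _ G cG) => //; rewrite CG.
exact: subset_closure.
Qed.

Lemma points_stably_compactly_based : stably_compactly_based (points L).
Proof.
apply/stably_compactly_basedP; split; first exact: points_sober.
apply: order_iso_arithmetic to_opensK of_opensK to_opens_le of_opens_le ariL.
Qed.

End PointsSpace.

Definition opens_ariFrame (T : skbSpace) : ariFrame :=
  AriFrame (proj2 (proj1 stably_compactly_basedP (skb_ax T))).

Theorem StKBSp_dually_equivalent_AriFrm :
  cat_dually_equivalent StKBSp_car StKBSp_hom AriFrm_car AriFrm_hom.
Proof.
have sob (T : skbSpace) : sober T by case: (skb_ax T).
exists opens_ariFrame, (fun X Y f hf => opens_preimage (proj1 hf)).
split=> [X Y f hf|].
  split; first exact: opens_preimage_hom.
  move=> U /opens_compactP cU; apply/opens_compactP => /=.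
  by apply: (proj2 hf); split=> //; exact: svalP.
split=> [X hf U|]; first exact: sval_eq.
split=> [X Y Z f g hf hg hgf U|]; first exact: sval_eq.
split=> [X Y f g hf hg fg x|].
  apply: sober_eq; first exact: sob.
  move=> U oU; have /(congr1 sval)/= E := fg (exist _ U oU : opens _).
  by rewrite -[U (f x)]/((f @^-1` U) x) E.
split=> [X Y h [hf hc]|L].
  have [f [cf E]] := opens_preimage_full (sob Y) hf.
  suff hfm : StKBSp_hom f by exists f, hfm => U; rewrite -E; exact: sval_eq.
  split=> // U [cU oU].
  pose V : opens Y := exist _ U oU.
  have /opens_compactP : fcompact (h V) by apply: hc; exact/opens_compactP.
  by rewrite -E.
have ariL := af_ax L.
exists (SKBSpace (points_stably_compactly_based ariL)).
have [toK ofK] := (to_opensK ariL, of_opensK ariL).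
have [tole ofle] := (@to_opens_le L, @of_opens_le L).
exists (@to_opens L), (@of_opens L); split=> //; split.
- exact: order_iso_frame_hom toK ofK tole ofle.
- exact: order_iso_coherent toK ofK tole ofle.
- exact: order_iso_frame_hom ofK toK ofle tole.
- exact: order_iso_coherent ofK toK ofle tole.
Qed.

(** * Priestley spaces and L-spaces *)

Section Priestley.
Context {X : topologicalType} (le : X -> X -> Prop).
Hypothesis priestleyX : priestley_space le.

Let lexx x : le x x. Proof. by have [_ []] := priestleyX. Qed.
Let le_trans x y z : le x y -> le y z -> le x z.
Proof. by have [_ [_ _ tr] _] := priestleyX; exact: tr. Qed.
Let le_sep x y : ~ le x y -> exists U, [/\ clopen_upset le U, U x & ~ U y].
Proof.
by have [_ _ sep] := priestleyX => /sep[U [cU uU Ux nUy]]; exists U; split.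
Qed.

Lemma priestley_closed_compact (A : set X) : closed A -> compact A.
Proof.
have [[cX _ _] _ _] := priestleyX => cA; exact: subclosed_compact cA cX _.
Qed.

Lemma clopen_compact (A : set X) : clopen A -> compact A.
Proof. by move=> [_]; exact: priestley_closed_compact. Qed.

Lemma clopen_upset0 : clopen_upset le set0.
Proof. by split=> //; split; [exact: open0|exact: closed0]. Qed.

Lemma clopen_upsetT : clopen_upset le setT.
Proof. by split=> //; split; [exact: openT|exact: closedT]. Qed.

Lemma clopen_upsetI U V :
  clopen_upset le U -> clopen_upset le V -> clopen_upset le (U `&` V).
Proof.
move=> [cU uU] [cV uV]; split; first exact: clopenI.
by move=> x y [Ux Vx] xy; split; [exact: uU xy|exact: uV xy].
Qed.

Lemma clopen_upsetU U V :
  clopen_upset le U -> clopen_upset le V -> clopen_upset le (U `|` V).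
Proof.
move=> [cU uU] [cV uV]; split; first exact: clopenU.
by move=> x y [Ux|Vx] xy; [left; exact: uU xy|right; exact: uV xy].
Qed.

Lemma downset_point_closed x : closed (downset_of le [set x]).
Proof.
rewrite -openC openE => y nyx.
have [U [[[oU _] uU] Uy nUx]] : exists U, [/\ clopen_upset le U, U y & ~ U x].
  by apply: le_sep => yx; apply: nyx; exists x.
apply: filterS (open_nbhs_nbhs (conj oU Uy)) => z Uz [_ -> zx].
by apply: nUx; exact: uU Uz zx.
Qed.

Lemma open_upset_nbhs U x : open U -> upset le U -> U x ->
  exists V, [/\ clopen_upset le V, V x & V `<=` U].
Proof.
move=> oU uU Ux.
pose S := [set ~` V | V in [set V | clopen_upset le V /\ V x]].
have [|||||_ [V [cV Vx] <-] UV] := @compact_directed_cover X (~` U) S.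
- exact/priestley_closed_compact/open_closedC.
- by move=> _ [V [[[_ cV] _] _] <-]; exact: closed_openC.
- by exists setT; [split=> //; exact: clopen_upsetT|exact: setCT].
- move=> _ _ [V [cV Vx] <-] [W [cW Wx] <-]; exists (V `&` W).
    by split; [exact: clopen_upsetI|split].
  by rewrite setCI.
- move=> y nUy; have [V [cV Vx nVy]] : exists V,
      [/\ clopen_upset le V, V x & ~ V y].
    by apply: le_sep => xy; apply: nUy; exact: uU xy.
  by exists (~` V) => //; exists V.
by exists V; split=> // y Vy; apply: contrapT => /UV.
Qed.

Lemma clopen_upset_basis (O : set X) y : open O -> O y ->
  exists U V, [/\ clopen_upset le U, clopen_upset le V, U y, ~ V y &
    U `\` V `<=` O].
Proof.
move=> oO Oy.
pose S : set (set X) := [set W | exists U V,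
  [/\ clopen_upset le U, clopen_upset le V, U y, ~ V y & W = ~` U `|` V]].
have [|||||_ [U [V [cU cV Uy nVy ->]]] OUV] :=
    @compact_directed_cover X (~` O) S.
- exact/priestley_closed_compact/open_closedC.
- move=> _ [U [V [[[_ cU] _] [[oV _] _] _ _ ->]]].
  by apply: openU => //; exact: closed_openC.
- exists setT, set0; rewrite setCT setU0.
  by split=> //; [exact: clopen_upsetT|exact: clopen_upset0].
- move=> _ _ [U [V [cU cV Uy nVy ->]]] [U' [V' [cU' cV' U'y nV'y ->]]].
  exists (U `&` U'), (V `|` V'); split=> //.
  + exact: clopen_upsetI.
  + exact: clopen_upsetU.
  + by case.
  + by rewrite setCI setUACA.
- move=> z nOz.
  have [yz|/le_sep[U [cU Uy nUz]]] := pselect (le y z); last first.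
    exists (~` U `|` set0); last by left.
    exists U, set0; split=> //; exact: clopen_upset0.
  have [zy|/le_sep[V [cV Vz nVy]]] := pselect (le z y).
    have [_ [_ anti _] _] := priestleyX.
    by case: nOz; rewrite -(anti _ _ yz zy).
  exists (~` setT `|` V); last by right.
  exists setT, V; split=> //; exact: clopen_upsetT.
exists U, V; split=> // z [Uz nVz]; apply: contrapT => /OUV[|] //.
Qed.

(** Zorn's lemma is applied to the points of [V] below [x], with the order reversed. If a chain had
    no lower bound in [V], the complements of the principal downsets of its members would cover [V];
    by compactness one of them would, yet it omits its own generator. *)
Lemma minimal_below (V : set X) x : closed V -> V x ->
  exists2 m, minimals le V m & le m x.
Proof.
move=> cV Vx; have [_ [_ anti _] _] := priestleyX.
pose D := {y | V y /\ le y x}.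
pose x0 : D := exist _ x (conj Vx (lexx x)).
have [|||C Ctot|[m [Vm mx]] mmin] :=
  @Zorn D (fun y z => `[< le (sval z) (sval y) >]).
- by move=> y; exact/asboolP.
- by move=> y z t /asboolP zy /asboolP tz; apply/asboolP/(le_trans tz).
- move=> [y Dy] [z Dz] /asboolP/= zy /asboolP/= yz.
  by apply: eq_exist; exact: anti.
- have [[y0 Cy0]|C0] := pselect (C !=set0); last first.
    by exists x0 => y Cy; case: C0; exists y.
  suff [y [Vy yC]] : exists y, V y /\ forall z, C z -> le y (sval z).
    have yx : le y x by apply: le_trans (yC _ Cy0) (proj2 (svalP y0)).
    by exists (exist _ y (conj Vy yx)) => z Cz; apply/asboolP; exact: yC.
  pose S : set (set X) := [set W | W = set0 \/
    exists2 z, C z & W = ~` downset_of le [set sval z]].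
  apply: contrapT => nlb.
  have [|||||W] := @compact_directed_cover X V S.
  + exact: priestley_closed_compact.
  + move=> _ [->|[z _ ->]]; first exact: open0.
    exact/closed_openC/downset_point_closed.
  + by left.
  + move=> U W [->|[y Cy ->]]; first by rewrite set0U.
    move=> [->|[z Cz ->]]; first by rewrite setU0; right; exists y.
    right; have [/asboolP zy|/asboolP yz] := Ctot _ _ Cy Cz.
      exists z => //; apply/setUidPr => t nty [_ -> tz].
      by apply: nty; exists (sval y) => //; exact: le_trans tz zy.
    exists y => //; apply/setUidPl => t ntz [_ -> ty].
    by apply: ntz; exists (sval z) => //; exact: le_trans ty yz.
  + move=> y Vy; apply: contrapT => nS; apply: nlb; exists y; split=> // z Cz.
    apply: contrapT => nyz; apply: nS.
    exists (~` downset_of le [set sval z]); first by right; exists z.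
    by move=> [_ -> yz].
  + move=> [->|[z Cz ->]] VW; first by exact: VW Vx.
    by apply: (VW (sval z)); [exact: (proj1 (svalP z))|exists (sval z)].
exists m => //; split=> // y Vy ym.
have yx := le_trans ym mx.
by have /(congr1 sval) := mmin (exist _ y (conj Vy yx)) (asboolT ym).
Qed.

End Priestley.

(** * The frame of clopen upsets of an L-space *)

Section LSpace.
Context {X : topologicalType} (le : X -> X -> Prop).
Hypothesis LX : L_space le.

Let priestleyX : priestley_space le. Proof. by case: LX. Qed.

(** A clopen [C] around [y] missing the closure of [W] has an open downset containing [x]. That
    downset meets [W], hence so does [C]. *)
Lemma closure_upset (W : set X) : upset le W -> upset le (closure W).
Proof.
move=> uW x y clx xy; apply: contrapT => ncly.
have [[_ _ zdim] _ _] := priestleyX; have [_ downX _] := LX.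
have [C [cC Cy CW]] : exists C, [/\ clopen C, C y & C `<=` ~` closure W].
  by apply: zdim ncly; apply: closed_openC; exact: closed_closure.
have [oD _] := downX _ cC.
have [|w [Ww [c Cc wc]]] := clx (downset_of le C).
  by apply: open_nbhs_nbhs; split=> //; exists y.
by apply: (CW c Cc); apply: subset_closure; exact: uW wc.
Qed.

Fact clopen_upset_axioms : set_frame_axioms (clopen_upset le) closure.
Proof.
split; first exact: clopen_upsetI.
- move=> I S F cF; have oF : open (\bigcup_(i in S) F i).
    by apply: bigcup_open => i /cF[[]].
  have uF : upset le (\bigcup_(i in S) F i).
    by move=> x y [i Si Fx] xy; exists i => //; have [_ uF] := cF _ Si;
      exact: uF xy.
  split; last exact: closure_upset.
  by split; [case: LX => _ _; apply|exact: closed_closure].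
- exact: subset_closure.
- move=> A U [[_ cU] _] AU.
  by rewrite (proj1 (closure_id U) cU); exact: closureS.
- move=> I S F U [[oU _] _] _ x [Ux clx] B Bx.
  have [|y [[i Si Fy] [By Uy]]] := clx (B `&` U).
    by apply: filterI => //; exact: open_nbhs_nbhs.
  by exists y; split=> //; exists i.
Qed.

Definition clopen_upsets : frame := set_frame clopen_upset_axioms.

Lemma clopen_upset_bigcup (W : set X) : open W -> upset le W ->
  W = \bigcup_(V in [set V | clopen_upset le V /\ V `<=` W]) V.
Proof.
move=> oW uW; apply/seteqP; split=> x; last by case=> V [_ VW] /VW.
by move=> /(open_upset_nbhs priestleyX oW uW)[V [cV Vx VW]]; exists V.
Qed.

Lemma compact_upset_cover (V : set X) (S : set (set X)) :
  compact V -> S `<=` clopen_upset le -> S set0 ->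
  (forall U W, S U -> S W -> S (U `|` W)) ->
  V `<=` \bigcup_(U in S) U -> exists2 U, S U & V `<=` U.
Proof.
by move=> cV Sc; apply: compact_directed_cover => // U /Sc[[]].
Qed.

(** An open upset is the union of the clopen upsets inside it, and a finite union of these is
    closed, so the closure disappears on the left. Conversely, the union of a family is an open
    upset, and compactness of [U] extracts a finite subfamily. *)
Lemma clopen_upsets_way_belowP (U V : clopen_upsets) :
  way_below U V <-> Lway_below le (sval U) (sval V).
Proof.
split=> [/set_frame_way_belowP UV W oW uW VW|UV].
  have [||T [fT TW UT]] := UV [set V | clopen_upset le V /\ V `<=` W].
  - by move=> ? [].
  - by rewrite -clopen_upset_bigcup.
  apply: subset_trans UT _.
  have TE : closed (\bigcup_(V in T) V).
    elim/finite_set_ind: T / fT TW => [_|A T _ IH TW].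
      by rewrite bigcup_set0; exact: closed0.
    rewrite bigcup_setU1; apply: closedU.
      by have [|[[]]] := TW A; first by left.
    by apply: IH => B TB; apply: TW; right.
  by rewrite -(proj1 (closure_id _) TE) => x [A /TW[_ AW] /AW].
apply/set_frame_way_belowP => S SC VS.
have {VS}US : sval U `<=` \bigcup_(W in S) W.
  apply: UV VS; first by apply: bigcup_open => W /SC[[]].
  by move=> x y [W SW Wx] xy; exists W => //; have [_ uW] := SC _ SW;
    exact: uW xy.
have [||T [fT TS UT]] :=
    proj1 (compact_finitely_covered _) (clopen_compact priestleyX _) S _ US.
- by have [] := svalP U.
- by move=> W /SC[[]].
by exists T; split=> //; apply: subset_trans UT _; exact: subset_closure.
Qed.

(** For [m] minimal in a compact [U], let [W] be the complement of the downset of [m]. Were [m] in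
    the closure of [W], all of [U] would be, forcing [U] into [W]; so the downset is the complement
    of the open set [closure W]. Conversely, the open downset of a minimal [m] meets any upset [W]
    whose closure contains [m], which puts [m] and everything above it into [W]. *)
Lemma clopen_scott_upsetP (U : clopen_upsets) :
  fcompact U <-> clopen_scott_upset le (sval U).
Proof.
have [cU uU] := svalP U; have [_ _ oclX] := LX.
have [_ [lexx anti _] _] := priestleyX.
rewrite /fcompact; split=> [/clopen_upsets_way_belowP UU|[_ [_ _ minU]]].
  split=> //; split=> //; first by case: cU.
  move=> m [Um mmin]; rewrite /spatial_part /=.
  pose W := ~` downset_of le [set m].
  have oW : open W by exact/closed_openC/downset_point_closed.
  have uW : upset le W.
    move=> x y nx xy [_ -> ym]; apply: nx; exists m => //.
    by have [_ [_ _ tr] _] := priestleyX; exact: tr xy ym.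
  have nclm : ~ closure W m.
    move=> clm; have /(_ m Um) : sval U `<=` W.
      apply: UU => // x Ux; have [xm|] := pselect (le x m).
        by rewrite (mmin _ Ux xm).
      by move=> nxm; apply: subset_closure => -[_ -> /nxm].
    by apply; exists m.
  suff -> : downset_of le [set m] = ~` closure W.
    split; first exact/closed_openC/closed_closure.
    exact/open_closedC/oclX.
  apply/seteqP; split=> x.
    by move=> [_ -> xm] clx; apply: nclm; exact: closure_upset xm.
  by move=> nclx; apply: contrapT => nx; apply: nclx; exact: subset_closure.
apply/clopen_upsets_way_belowP => W oW uW UW x Ux.
have [m Um mx] := minimal_below priestleyX (proj2 cU) Ux.
have [om _] := minU _ Um.
have [|w [Ww [_ -> wm]]] := UW _ (proj1 Um) (downset_of le [set m]).
  by apply: open_nbhs_nbhs; split=> //; exists m.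
exact: uW (uW _ _ Ww wm) mx.
Qed.

Lemma closure_core (U : clopen_upsets) : closure (core le (sval U)) =
  sval (fsup [set K : clopen_upsets | fcompact K /\ fle K U]).
Proof.
congr closure; apply/seteqP; split=> x.
  move=> [V [sV VU Vx]]; have [cV [_ uV _]] := sV.
  pose K : clopen_upsets := exist _ V (conj cV uV).
  by exists K => //; split=> //; apply/clopen_scott_upsetP.
by move=> [K [/clopen_scott_upsetP cK KU] Kx]; exists (sval K).
Qed.

(** Density of the core translates through [closure_core]. The kernel condition gives, at each point
    of [U], a clopen upset way below the intersection; compactness of [U] merges them into one.
    Conversely, the intersection of witnesses for the two kernels is a witness for the kernel of the
    intersection. *)
Lemma arithmetic_L_spaceP :
  arithmetic_L_space le <-> arithmetic_frame clopen_upsets.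
Proof.
split=> [[_ dns kerI]|[alg st]].
  split=> [U|U V W].
    apply: fle_antisym; last by apply: fsup_least => K [].
    by apply/set_frame_leP; rewrite -closure_core; exact/dns/svalP.
  move=> /clopen_upsets_way_belowP UV /clopen_upsets_way_belowP UW.
  apply/clopen_upsets_way_belowP.
  pose S := [set A | clopen_upset le A /\
                     Lway_below le A (sval V `&` sval W)].
  have [|||||A [cA AVW] UA] := @compact_upset_cover (sval U) S.
  - by apply: (clopen_compact priestleyX); have [] := svalP U.
  - by move=> A [].
  - by split; [exact: clopen_upset0|move=> *; exact: sub0set].
  - move=> A B [cA AVW] [cB BVW]; split; first exact: clopen_upsetU.
    by move=> O oO uO VWO; rewrite subUset; split; [exact: AVW|exact: BVW].
  - move=> x Ux.
    have : ker le (sval V `&` sval W) x.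
      rewrite kerI; [|exact: svalP..].
      by split; exists (sval U); split=> //; exact: svalP.
    by move=> [A [cA AVW Ax]]; exists A.
  - by move=> O oO uO VWO; apply: subset_trans UA _; exact: AVW.
split=> // [U cU x Ux|U V cU cV].
  pose K : clopen_upsets := exist _ U cU.
  by rewrite -[U]/(sval K) closure_core -alg.
have wI A (cA : clopen_upset le A) B (cB : clopen_upset le B) :
    Lway_below le A B <-> way_below (exist _ A cA : clopen_upsets)
                                    (exist _ B cB : clopen_upsets).
  by rewrite clopen_upsets_way_belowP.
have cUV := clopen_upsetI cU cV.
apply/seteqP; split=> x.
  by move=> [A [cA AUV Ax]]; split; exists A; split=> // W oW uW WA;
    apply: AUV => // y [Uy Vy]; exact: WA.
move=> [[A [cA AU Ax]] [B [cB BV Bx]]]; exists (A `&` B).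
have cAB := clopen_upsetI cA cB.
split=> //; apply/(wI _ cAB _ cUV).
have -> : exist _ _ cUV =
    fmeet (exist _ U cU : clopen_upsets) (exist _ V cV : clopen_upsets).
  exact: sval_eq.
apply: st.
  exact: way_below_le (fmeet_lbl (exist _ A cA : clopen_upsets)
    (exist _ B cB)) (proj1 (wI A cA U cU) AU) (fle_refl _).
exact: way_below_le (fmeet_lbr (exist _ A cA : clopen_upsets)
  (exist _ B cB)) (proj1 (wI B cB V cV) BV) (fle_refl _).
Qed.

Lemma prime_filter_point (F : set clopen_upsets) : prime_filter F ->
  exists x, forall U : clopen_upsets, F U <-> sval U x.
Proof.
move=> [FT Fup FI F0 FU]; have [[cX _ _] _ _] := priestleyX.
pose S : set (set X) := [set W | exists U V : clopen_upsets,
  [/\ F U, ~ F V & W = ~` sval U `|` sval V]].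
apply: contrapT => nx.
have [|||||_ [U [V [FUU nFV ->]]] UV] := @compact_directed_cover X setT S.
- by [].
- move=> _ [U [V [_ _ ->]]]; have [[_ cU] _] := svalP U.
  by have [[oV _] _] := svalP V; apply: openU => //; exact: closed_openC.
- exists (exist _ setT (clopen_upsetT le)), (exist _ set0 (clopen_upset0 le)).
  split; last by rewrite /= setCT setU0.
    by apply: Fup FT _; apply/set_frame_leP.
  by move=> F0'; apply: F0; apply: Fup F0' _; apply/set_frame_leP.
- move=> _ _ [U [V [FUU nFV ->]]] [U' [V' [FU' nFV' ->]]].
  exists (fmeet U U'),
    (exist _ _ (clopen_upsetU (svalP V) (svalP V'))); split.
  + exact: FI.
  + move=> FVV'; have [//|//] : F V \/ F V'.
    apply: FU; apply: Fup FVV' _; apply/set_frame_leP => x /= [Vx|Vx].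
      by apply: (fle_joinl V V').
    by apply: (fle_joinr V V').
  + by rewrite /= setCI setUACA.
- move=> x _; apply: contrapT => nS; apply: nx; exists x => U; split=> [FUU|Ux].
    apply: contrapT => nUx; apply: nS.
    exists (~` sval U `|` set0); last by left.
    exists U, (exist _ set0 (clopen_upset0 le)); split=> // F0'; apply: F0.
    by apply: Fup F0' _; apply/set_frame_leP.
  apply: contrapT => nFU; apply: nS.
  exists (~` setT `|` sval U); last by right.
  exists (exist _ setT (clopen_upsetT le)), U; split=> //.
  by apply: Fup FT _; apply/set_frame_leP.
apply: nFV; apply: Fup FUU _; apply/set_frame_leP => x Ux.
by have [] := UV x I.
Qed.

Lemma clopen_upsets_separate (x y : X) :
  (forall U : clopen_upsets, sval U x <-> sval U y) -> x = y.
Proof.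
have [_ [_ anti _] sep] := priestleyX => xy; apply: anti; apply: contrapT.
  move=> /sep[U [cU uU Ux]]; apply.
  exact: (proj1 (xy (exist _ U (conj cU uU)))).
move=> /sep[U [cU uU Ux]]; apply.
exact: (proj2 (xy (exist _ U (conj cU uU)))).
Qed.

End LSpace.

(** * The spectrum of prime filters *)

Definition spectrum (L : frame) : Type := {F : set L | prime_filter F}.

HB.instance Definition _ (L : frame) := gen_eqMixin (spectrum L).
HB.instance Definition _ (L : frame) := gen_choiceMixin (spectrum L).

Definition spec_le (L : frame) (x y : spectrum L) : Prop := sval x `<=` sval y.

Definition spec_at (L : frame) (a : L) : set (spectrum L) := [set x | sval x a].

Section SpectrumTopology.
Variable L : frame.
Implicit Types (a b c : L) (x y : spectrum L).

Lemma spec_at_mono a b : fle a b -> spec_at a `<=` spec_at b.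
Proof. by move=> ab x xa; have [_ xup _ _ _] := svalP x; exact: xup xa ab. Qed.

Lemma spec_atT : spec_at (ftop L) = setT.
Proof. by apply/seteqP; split=> // x; have [] := svalP x. Qed.

Lemma spec_at0 : spec_at (fbot L) = set0.
Proof. by apply/seteqP; split=> // x; have [] := svalP x. Qed.

Lemma spec_atI a b : spec_at (fmeet a b) = spec_at a `&` spec_at b.
Proof.
apply/seteqP; split=> [x xab|].
  by split; apply: spec_at_mono xab; [exact: fmeet_lbl|exact: fmeet_lbr].
by move=> x [xa xb]; have [_ _ xI _ _] := svalP x; exact: xI.
Qed.

Lemma spec_atU a b : spec_at (fjoin a b) = spec_at a `|` spec_at b.
Proof.
apply/seteqP; split=> x; first by have [_ _ _ _ xU] := svalP x; exact: xU.
by move=> [|]; apply: spec_at_mono; [exact: fle_joinl|exact: fle_joinr].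
Qed.

Lemma spec_at_le a b : spec_at a `<=` spec_at b -> fle a b.
Proof.
move=> ab; apply: contrapT => /prime_filter_separates[F [pF Fa]]; apply.
exact: (ab (exist _ F pF)).
Qed.

(** The differences [spec_at a]\[spec_at b] are closed under finite intersections, so they form a
    basis of the topology generated by the sets [spec_at a] and their complements. *)
Definition spec_open : set_system (spectrum L) := [set U |
  forall x, U x -> exists a b,
    [/\ spec_at a x, ~ spec_at b x & spec_at a `\` spec_at b `<=` U]].

Fact spec_openT : spec_open setT.
Proof.
move=> x _; exists (ftop L), (fbot L).
by rewrite spec_atT spec_at0; split.
Qed.

Fact spec_openI : setI_closed spec_open.
Proof.
move=> U V oU oV x [/oU[a [b [xa nxb abU]]] /oV[a' [b' [xa' nxb' abV]]]].
exists (fmeet a a'), (fjoin b b'); rewrite spec_atI spec_atU; split=> //.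
  by case.
by move=> y [[ya ya'] /not_orP[nyb nyb']]; split; [exact: abU|exact: abV].
Qed.

Fact spec_open_bigU (I : Type) (f : I -> set (spectrum L)) :
  (forall i, spec_open (f i)) -> spec_open (\bigcup_i f i).
Proof.
move=> of_ x [i _ /of_[a [b [xa nxb abf]]]]; exists a, b; split=> //.
by move=> y /abf fy; exists i.
Qed.

End SpectrumTopology.

HB.instance Definition _ (L : frame) :=
  isOpenTopological.Build (spectrum L)
    (@spec_openT L) (@spec_openI L) (@spec_open_bigU L).

Section SpectrumSpace.
Variable L : frame.
Implicit Types (a b c : L) (x y : spectrum L) (U : set (spectrum L)).

Lemma spec_openP U : open U <->
  forall x, U x -> exists a b,
    [/\ spec_at a x, ~ spec_at b x & spec_at a `\` spec_at b `<=` U].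
Proof. by []. Qed.

Lemma spec_at_clopen a : clopen (spec_at a).
Proof.
split; [|rewrite -openC]; apply/spec_openP => x xa.
  by exists a, (fbot L); rewrite spec_at0 setD0; split.
by exists (ftop L), a; split=> //; rewrite spec_atT.
Qed.

Lemma spec_at_clopen_upset a : clopen_upset (@spec_le L) (spec_at a).
Proof. by split; [exact: spec_at_clopen|move=> x y xa; apply]. Qed.

Lemma clopenC (T : topologicalType) (U : set T) : clopen U -> clopen (~` U).
Proof. by move=> [oU cU]; split; [exact: closed_openC|exact: open_closedC]. Qed.

Lemma spec_patch_clopen a b : clopen (spec_at a `\` spec_at b).
Proof.
by rewrite setDE; apply/clopenI/clopenC/spec_at_clopen/spec_at_clopen.
Qed.

(* An ultrafilter [G] on the spectrum converges to the prime filter of those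
   [a] whose basic open set belongs to [G]. *)
Lemma spectrum_compact : compact [set: spectrum L].
Proof.
rewrite compact_ultra => G GU _.
pose F : set L := [set a | G (spec_at a)].
have pF : prime_filter F.
  split; rewrite /F /=.
  - by rewrite spec_atT; exact: filterT.
  - by move=> a b Ga ab; apply: filterS Ga; exact: spec_at_mono.
  - by move=> a b Ga Gb; rewrite spec_atI; exact: filterI.
  - by rewrite spec_at0; exact: filter_not_empty.
  - move=> a b; rewrite spec_atU => Gab; apply: contrapT => /not_orP[nGa nGb].
    have [//|Ga] := @in_ultra_setVsetC _ _ (spec_at a) GU.
    apply: nGb; apply: filterS (filterI Gab Ga) => x [[|//]].
    by [].
exists (exist _ F pF); split=> // B; rewrite nbhsE.
move=> [U [/spec_openP oU /oU[a [b [Fa nFb abU]]]] UB].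
apply: filterS UB _; apply: filterS abU _; apply: filterI => //.
by have [|//] := @in_ultra_setVsetC _ _ (spec_at b) GU.
Qed.

Lemma spectrum_priestley : priestley_space (@spec_le L).
Proof.
split.
- split; first exact: spectrum_compact.
    rewrite open_hausdorff => x y /eqP xy.
    have [a ha] : exists a, ~ (spec_at a x <-> spec_at a y).
      apply: contrapT => nex; apply: xy; apply: sval_eq.
      apply/seteqP; split=> a xa; apply: contrapT => nya; apply: nex.
        by exists a => -[/(_ xa)].
      by exists a => -[_ /(_ xa)].
    have [oa ca] := spec_at_clopen a.
    have [xa|nxa] := pselect (spec_at a x).
      exists (spec_at a, ~` spec_at a); split=> /=; rewrite ?inE//=.
      + by move=> ya; apply: ha.
      + exact: closed_openC.
      + by rewrite setICr.
    exists (~` spec_at a, spec_at a); split=> /=; rewrite ?inE//=.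
    + by apply: contrapT => nya; apply: ha.
    + exact: closed_openC.
    + by rewrite setICl.
  move=> U /spec_openP oU x /oU[a [b [xa nxb abU]]].
  by exists (spec_at a `\` spec_at b); split=> //; exact: spec_patch_clopen.
- split=> [x|x y xy yx|x y z xy yz].
  + exact: subset_refl.
  + by apply: sval_eq; apply/seteqP.
  + exact: subset_trans xy yz.
- move=> x y /existsNP[a /not_implyP[xa nya]]; exists (spec_at a).
  by have [] := spec_at_clopen_upset a; split.
Qed.

(** This is the Heyting implication of the frame. *)
Definition fimp a b : L := fsup [set c | fle (fmeet a c) b].

Lemma fimp_meet_le a b : fle (fmeet a (fimp a b)) b.
Proof. by apply: fmeet_sup_le. Qed.

(** The filter generated by [x] and [a] contains [b] only if [x] contains the implication. Otherwise
    it extends to a prime filter that contains [a] and avoids [b]. *)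
Lemma downset_spec_patch a b :
  downset_of (@spec_le L) (spec_at a `\` spec_at b) = ~` spec_at (fimp a b).
Proof.
apply/seteqP; split=> [x [y [ya nyb] xy] xi|x nxi].
  apply: nyb; apply: spec_at_mono (fimp_meet_le a b) _ _.
  by rewrite spec_atI; split=> //; exact: xy.
have [xT xup xI _ _] := svalP x.
pose F : set L := [set z | exists2 d, sval x d & fle (fmeet d a) z].
have [||||P [pP FP nPb]] := @prime_filter_exists L F b.
- by exists (ftop L) => //; exact: fle_top.
- by move=> z z' [d xd dz] zz'; exists d => //; exact: fle_trans zz'.
- move=> z z' [d xd dz] [d' xd' dz']; exists (fmeet d d'); first exact: xI.
  apply: fmeet_greatest.
    apply: fle_trans dz; apply: fmeet_mono; [exact: fmeet_lbl|exact: fle_refl].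
  by apply: fle_trans dz'; apply: fmeet_mono;
    [exact: fmeet_lbr|exact: fle_refl].
- move=> [d xd da]; apply: nxi; apply: (xup d) => //.
  by apply: fsup_ub; rewrite /= fmeetC.
exists (exist _ P pP).
  split=> //; apply: FP; exists (ftop L) => //; exact: fmeet_lbr.
by move=> d xd; apply: FP; exists d => //; exact: fmeet_lbl.
Qed.

Lemma downset_ofU (T : topologicalType) (le : T -> T -> Prop) (A B : set T) :
  downset_of le (A `|` B) = downset_of le A `|` downset_of le B.
Proof.
apply/seteqP; split=> x; first by move=> [y [?|?] xy]; [left|right]; exists y.
by move=> [|] [y ? xy]; exists y => //; [left|right].
Qed.

(** A clopen set is compact, hence a finite union of basic differences, and downsets commute with
    unions. The family [S] is arranged so that the single covering member is [U] itself. *)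
Lemma spectrum_downset_clopen U :
  clopen U -> clopen (downset_of (@spec_le L) U).
Proof.
move=> [oU cU].
have cpU := priestley_closed_compact spectrum_priestley cU.
have down0 : downset_of (@spec_le L) set0 = set0.
  by apply/seteqP; split=> // x [].
pose S : set (set (spectrum L)) := [set V |
  [/\ V `<=` U, open V & clopen (downset_of (@spec_le L) V)]].
have [||||V [VU _ cV] UV] := compact_directed_cover cpU (S := S).
- by move=> V [].
- rewrite /S /= down0; split; [exact: sub0set|exact: open0|].
  by split; [exact: open0|exact: closed0].
- move=> V W [VU oV cV] [WU oW cW]; rewrite /S /= downset_ofU; split.
  + by rewrite subUset.
  + exact: openU.
  + exact: clopenU.
- move=> x Ux; have [a [b [xa nxb abU]]] := proj1 (spec_openP U) oU _ Ux.
  exists (spec_at a `\` spec_at b) => //; split=> //.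
    by case: (spec_patch_clopen a b).
  by rewrite downset_spec_patch; exact/clopenC/spec_at_clopen.
by have -> : U = V by apply/seteqP.
Qed.

(** If a basic difference of [a] and [b] around [x] missed every [spec_at s], then [b] would be
    above each meet of [a] with [s]. By the frame law it would be above the meet of [a] with the
    join, and so belong to [x]. *)
Lemma spec_at_sup (S : set L) :
  spec_at (fsup S) = closure (\bigcup_(a in S) spec_at a).
Proof.
apply/seteqP; split; last first.
  have [_ /closure_id ->] := spec_at_clopen (fsup S).
  by apply: closureS => x [a Sa]; apply: spec_at_mono; exact: fsup_ub.
move=> x xS B; rewrite nbhsE.
move=> [U [/spec_openP oU /oU[a [b [xa nxb abU]]]] UB].
apply: contrapT => nSB; apply: nxb.
apply: (@spec_at_mono _ (fmeet a (fsup S))); last by rewrite spec_atI.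
apply: fmeet_sup_le => s Ss; apply: spec_at_le; rewrite spec_atI => y [ya ys].
apply: contrapT => nyb; apply: nSB; exists y; split; first by exists s.
by apply/UB/abU.
Qed.

Lemma spec_open_upset U : open U -> upset (@spec_le L) U ->
  U = \bigcup_(a in [set a | spec_at a `<=` U]) spec_at a.
Proof.
move=> oU uU; apply/seteqP; split=> x; last by move=> [a aU] /aU.
move=> Ux; pose S := [set ~` spec_at a | a in sval x].
have [xT xup xI _ _] := svalP x.
have cU : compact (~` U).
  by apply: (priestley_closed_compact spectrum_priestley); exact: open_closedC.
have [||||_ [a xa <-] aU] := compact_directed_cover cU (S := S).
- by move=> _ [a _ <-]; case: (clopenC (spec_at_clopen a)).
- by exists (ftop L) => //; rewrite spec_atT setCT.
- move=> _ _ [a xa <-] [b xb <-]; exists (fmeet a b); first exact: xI.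
  by rewrite spec_atI setCI.
- move=> y nUy; apply: contrapT => nS; apply: nUy; apply: uU Ux _ => a xa.
  by apply: contrapT => nya; apply: nS; exists (~` spec_at a) => //; exists a.
by exists a => // y ya; apply: contrapT => /aU.
Qed.

Lemma spectrum_L_space : L_space (@spec_le L).
Proof.
split; [exact: spectrum_priestley|exact: spectrum_downset_clopen|].
move=> U oU uU; rewrite (spec_open_upset oU uU) -spec_at_sup.
by case: (spec_at_clopen (fsup [set a | spec_at a `<=` U])).
Qed.

Section ClopenUpsetsOfSpectrum.
Variable LX : L_space (@spec_le L).
Let clups := clopen_upsets LX.

(** The proof [LX] stays a parameter because the frame depends on it, and in the duality it comes
    from the bundled arithmetic L-space. *)
Definition to_clopen_upsets (a : L) : clups :=
  exist _ _ (spec_at_clopen_upset a).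
Definition of_clopen_upsets (U : clups) : L :=
  fsup [set a | spec_at a `<=` sval U].

Lemma to_clopen_upsets_le a b :
  fle a b -> fle (to_clopen_upsets a) (to_clopen_upsets b).
Proof. by move=> ab; apply/set_frame_leP; exact: spec_at_mono. Qed.

Lemma of_clopen_upsets_le (U V : clups) :
  fle U V -> fle (of_clopen_upsets U) (of_clopen_upsets V).
Proof. by move=> UV; apply: fsup_mono => a; move=> /subset_trans; apply. Qed.

Lemma to_clopen_upsetsK : cancel to_clopen_upsets of_clopen_upsets.
Proof.
move=> a; apply: fle_antisym; last exact: fsup_ub.
by apply: fsup_least => b; exact: spec_at_le.
Qed.

Lemma of_clopen_upsetsK : cancel of_clopen_upsets to_clopen_upsets.
Proof.
move=> U; apply: sval_eq; rewrite /= spec_at_sup.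
have [[oU cU] uU] := svalP U.
by rewrite -(spec_open_upset oU uU) -(proj1 (closure_id _) cU).
Qed.

End ClopenUpsetsOfSpectrum.

Lemma spectrum_arithmetic :
  arithmetic_frame L -> arithmetic_L_space (@spec_le L).
Proof.
move=> ariL; apply/(arithmetic_L_spaceP spectrum_L_space).
apply: order_iso_arithmetic ariL.
- exact: to_clopen_upsetsK.
- exact: of_clopen_upsetsK.
- exact: to_clopen_upsets_le.
- exact: of_clopen_upsets_le.
Qed.

End SpectrumSpace.
Arguments to_clopen_upsets {L} LX a.
Arguments of_clopen_upsets {L} LX U.
Arguments to_clopen_upsetsK {L} LX.
Arguments of_clopen_upsetsK {L} LX.
Arguments to_clopen_upsets_le {L} LX a b.
Arguments of_clopen_upsets_le {L} LX U V.

(** * Coherent L-morphisms *)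

Section CompactJoin.
Context {X : topologicalType} (le : X -> X -> Prop).

Lemma clopen_scott_upset0 : clopen_scott_upset le set0.
Proof.
split; first by split; [exact: open0|exact: closed0].
by split=> //; [exact: closed0|move=> x []].
Qed.

Lemma clopen_scott_upsetU (U V : set X) : clopen_scott_upset le U ->
  clopen_scott_upset le V -> clopen_scott_upset le (U `|` V).
Proof.
move=> [cU [clU uU mU]] [cV [clV uV mV]]; split; first exact: clopenU.
split; first exact: closedU.
  by move=> x y [Ux|Vx] xy; [left; exact: uU xy|right; exact: uV xy].
move=> x [[Ux|Vx] xmin].
  by apply: mU; split=> // y Uy; apply: xmin; left.
by apply: mV; split=> // y Vy; apply: xmin; right.
Qed.

End CompactJoin.

(** * L-morphisms as homomorphisms between frames of clopen upsets *)

Section PreimageOfClopenUpsets.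
Context {X1 X2 : topologicalType}.
Variables (le1 : X1 -> X1 -> Prop) (le2 : X2 -> X2 -> Prop).
Variables (LX1 : L_space le1) (LX2 : L_space le2).
Let K1 := clopen_upsets LX1.
Let K2 := clopen_upsets LX2.

Lemma clopen_upset_preimage (f : X1 -> X2) (U : set X2) :
  L_morphism le1 le2 f -> clopen_upset le2 U ->
  clopen_upset le1 (f @^-1` U).
Proof.
move=> [cf mf _] [[oU cU] uU]; split; last first.
  by move=> x y Ufx xy; apply: uU Ufx _; exact: mf.
split; first exact: (proj1 (continuousP f)).
by exact: (proj1 (continuous_closedP f)).
Qed.

Definition clopen_upsets_preimage (f : X1 -> X2) (hf : L_morphism le1 le2 f)
    (U : K2) : K1 :=
  exist _ _ (clopen_upset_preimage hf (svalP U)).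

Lemma clopen_upsets_preimage_hom (f : X1 -> X2) (hf : L_morphism le1 le2 f) :
  frame_hom (clopen_upsets_preimage hf).
Proof.
split.
- apply: fle_antisym; first exact: fle_top.
  apply/set_frame_leP => x _; apply: subset_closure => /=.
  by exists (exist _ setT (clopen_upsetT le2)).
- by move=> U V; exact: sval_eq.
- move=> S; apply: sval_eq; rewrite /=; have [_ _ ->] := hf.
  + by rewrite preimage_bigcup bigcup_image.
  + by apply: bigcup_open => U _; have [[]] := svalP U.
  + move=> x y [U SU Ux] xy; exists U => //.
    by have [_ uU] := svalP U; exact: uU xy.
Qed.

(** A clopen Scott upset is its own core, so coherence covers its preimage by clopen Scott upsets
    lying inside it. These are closed under unions and the preimage is compact, so the preimage is
    one of them. *)
Lemma coherent_L_morphismP (f : X1 -> X2) (hf : L_morphism le1 le2 f) :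
  coherent_L_morphism le1 le2 f <->
  coherent_frame_hom (clopen_upsets_preimage hf).
Proof.
have [priestleyX1 _ _] := LX1.
split=> [[_ hc] K cK|hc].
  apply/clopen_scott_upsetP => /=.
  have /clopen_scott_upsetP sK := cK.
  have [cfK _] := clopen_upset_preimage hf (svalP K).
  pose S := [set V | clopen_scott_upset le1 V /\ V `<=` f @^-1` sval K].
  have [||||V [sV VK] KV] := compact_directed_cover
    (clopen_compact priestleyX1 cfK) (S := S).
  - by move=> V [[[]]].
  - by split; [exact: clopen_scott_upset0|exact: sub0set].
  - move=> V W [sV VK] [sW WK]; split; first exact: clopen_scott_upsetU.
    by rewrite subUset.
  - move=> x Kx; have [|V [sV VK Vx]] := hc _ (svalP K) x; last by exists V.
    by exists (sval K); split.
  by have -> : f @^-1` sval K = V by apply/seteqP.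
split=> // U cU x [V [sV VU Vfx]]; have [cV [_ uV _]] := sV.
exists (f @^-1` V); split=> //; last by move=> y /VU.
pose K : K2 := exist _ V (conj cV uV).
by have /clopen_scott_upsetP : fcompact (clopen_upsets_preimage hf K)
  by apply/hc/clopen_scott_upsetP.
Qed.

Lemma sval_fjoin (U V : K1) : sval (fjoin U V) = sval U `|` sval V.
Proof.
have -> : fjoin U V = exist _ _ (clopen_upsetU (svalP U) (svalP V)).
  apply: fle_antisym.
    by apply: fjoin_least; apply/set_frame_leP => x; [left|right].
  apply/set_frame_leP => x [] xU.
    by have /set_frame_leP := fle_joinl U V; apply.
  by have /set_frame_leP := fle_joinr U V; apply.
by [].
Qed.

Lemma sval_fbot : sval (fbot K1) = set0.
Proof. by rewrite /= bigcup_set0 closure0. Qed.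

(** The point [f x] is the one given by the prime filter of all [U] with [x] in [h U], so preimages
    under [f] are values of [h]. Continuity then follows from the basis of differences and
    monotonicity from Priestley separation. *)
Lemma clopen_upsets_preimage_full (h : K2 -> K1) : frame_hom h ->
  exists f (hf : L_morphism le1 le2 f), clopen_upsets_preimage hf =1 h.
Proof.
move=> [hT hI hS]; have [priestleyX2 _ _] := LX2.
have hle (U V : K2) : fle U V -> fle (h U) (h V).
  move=> UV; have -> : U = fmeet U V.
    by apply: fle_antisym; [apply: fmeet_greatest|exact: fmeet_lbl];
      first exact: fle_refl.
  by rewrite hI; exact: fmeet_lbr.
have pt x : exists y, forall U : K2, sval (h U) x <-> sval U y.
  apply: (prime_filter_point (F := [set U | sval (h U) x])); split.
  - rewrite /= hT; apply: subset_closure.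
    by exists (exist _ setT (clopen_upsetT le1)).
  - by move=> U V hx UV; have /set_frame_leP := hle _ _ UV; apply.
  - by move=> U V ? ?; rewrite /= hI.
  - by rewrite /mkset /fbot hS image_set0 -/(fbot K1) sval_fbot.
  - move=> U V; rewrite /mkset /fjoin hS image_setU !image_set1 -/(fjoin _ _).
    by rewrite sval_fjoin.
have [f fP] := choice pt.
have fE (U : K2) : f @^-1` sval U = sval (h U).
  by apply/seteqP; split=> x /fP.
have hf : L_morphism le1 le2 f.
  split.
  - apply/continuousP => O oO; rewrite openE => x Ofx.
    have [U [V [cU cV Ufx nVfx UVO]]] := clopen_upset_basis priestleyX2 oO Ofx.
    have oUV : open (sval (h (exist _ U cU)) `\` sval (h (exist _ V cV))).
      rewrite setDE; apply: openI.
        by have [[]] := svalP (h (exist _ U cU)).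
      by apply: closed_openC; have [[]] := svalP (h (exist _ V cV)).
    move: oUV; rewrite -!fE => oUV.
    by apply: filterS (open_nbhs_nbhs (conj oUV (conj Ufx nVfx))) => y /UVO.
  - move=> x y xy; apply: contrapT; have [_ _ sep] := priestleyX2.
    move=> /sep[U [cU uU Ufx]]; apply.
    have /fP hx : sval (exist _ U (conj cU uU) : K2) (f x) by [].
    have [_ uh] := svalP (h (exist _ U (conj cU uU))).
    by have /fP := uh _ _ hx xy.
  (* The closure of [W] is the join of the clopen upsets inside [W], so commutation with closure is
     preservation of this join by [h]. *)
  - move=> W oW uW; pose S : set K2 := [set V | sval V `<=` W].
    have SW : \bigcup_(V in S) sval V = W.
      apply/seteqP; split=> y; first by move=> [V VW] /VW.
      move=> /(open_upset_nbhs priestleyX2 oW uW)[V [cV Vy VW]].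
      by exists (exist _ V cV).
    have := fE (fsup S); rewrite hS /= SW bigcup_image => ->.
    rewrite -SW preimage_bigcup; congr closure.
    by apply: eq_bigcupr => V _; rewrite fE.
by exists f, hf => U; apply: sval_eq; rewrite /= fE.
Qed.

End PreimageOfClopenUpsets.
Arguments clopen_upsets_preimage {X1 X2 le1 le2} LX1 LX2 {f} hf U.

Definition ariLSpace_L_space (X : ariLSpace) : L_space (@als_le X) :=
  let: And3 LX _ _ := als_ax X in LX.

Definition clopen_upsets_ariFrame (X : ariLSpace) : ariFrame :=
  AriFrame (proj1 (arithmetic_L_spaceP (ariLSpace_L_space X)) (als_ax X)).

Theorem AriLPries_dually_equivalent_AriFrm :
  cat_dually_equivalent AriLPries_car AriLPries_hom AriFrm_car AriFrm_hom.
Proof.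
exists clopen_upsets_ariFrame, (fun X Y f hf => clopen_upsets_preimage
  (ariLSpace_L_space X) (ariLSpace_L_space Y) (proj1 hf)).
split=> [X Y f hf|].
  split; first exact: clopen_upsets_preimage_hom.
  exact: (proj1 (coherent_L_morphismP _ _ (proj1 hf))).
split=> [X hf U|]; first exact: sval_eq.
split=> [X Y Z f g hf hg hgf U|]; first exact: sval_eq.
split=> [X Y f g hf hg fg x|].
  apply: (@clopen_upsets_separate Y _ (ariLSpace_L_space Y)) => U.
  have /(congr1 sval)/= E := fg U.
  by rewrite -[sval U (f x)]/((f @^-1` sval U) x) E.
split=> [X Y h [hh hc]|L].
  have [f [hf E]] := clopen_upsets_preimage_full hh.
  suff hfc : AriLPries_hom f by exists f, hfc => U; rewrite -E; exact: sval_eq.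
  apply/(coherent_L_morphismP (ariLSpace_L_space X) (ariLSpace_L_space Y) hf).
  by move=> U cU; rewrite E; exact: hc.
have ariL := af_ax L.
pose X := AriLSpace (spectrum_arithmetic ariL).
pose LX : L_space (@spec_le L) := ariLSpace_L_space X; exists X.
have [toK ofK] := (to_clopen_upsetsK LX, of_clopen_upsetsK LX).
have [tole ofle] := (to_clopen_upsets_le LX, of_clopen_upsets_le LX).
exists (to_clopen_upsets LX), (of_clopen_upsets LX); split=> //; split.
- exact: order_iso_frame_hom toK ofK tole ofle.
- exact: order_iso_coherent toK ofK tole ofle.
- exact: order_iso_frame_hom ofK toK ofle tole.
- exact: order_iso_coherent ofK toK ofle tole.
Qed.

(** * Composing the dual equivalences *)

(** Essential surjectivity of [G] chooses [P a] with an isomorphism between [F a] and [G (P a)]. An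
    arrow [f] goes to a lift along the full functor [G'] of [F' f] conjugated by these isomorphisms.
    Identities and composites are checked after applying [G'], which is faithful. *)
Lemma cat_equivalent_of_dual (O1 O2 O3 : Type) (car1 : O1 -> Type)
    (H1 : forall a b : O1, (car1 a -> car1 b) -> Prop) (car2 : O2 -> Type)
    (H2 : forall a b : O2, (car2 a -> car2 b) -> Prop) (car3 : O3 -> Type)
    (H3 : forall a b : O3, (car3 a -> car3 b) -> Prop) :
  (forall a, H2 a a id) ->
  (forall a b c f g, H2 a b f -> H2 b c g -> H2 a c (g \o f)) ->
  (forall a b c f g, H3 a b f -> H3 b c g -> H3 a c (g \o f)) ->
  cat_dually_equivalent car1 H1 car3 H3 ->
  cat_dually_equivalent car2 H2 car3 H3 ->
  cat_equivalent car1 H1 car2 H2.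
Proof.
move=> id2 comp2 comp3 [F [F' [FH [Fid [FC [Ffaith [Ffull Fsurj]]]]]]].
move=> [G [G' [GH [Gid [GC [Gfaith [Gfull Gsurj]]]]]]].
have Q a : {d & {u : car3 (F a) -> car3 (G d) &
    {v | [/\ H3 _ _ u, H3 _ _ v, cancel u v & cancel v u]}}}.
  by have [d /cid[u /cid[v uv]]] := cid (Gsurj (F a)); exists d, u, v.
pose P a := projT1 (Q a).
pose u a : car3 (F a) -> car3 (G (P a)) := projT1 (projT2 (Q a)).
pose v a : car3 (G (P a)) -> car3 (F a) := sval (projT2 (projT2 (Q a))).
have [Hu Hv uK vK] : [/\ forall a, H3 _ _ (u a), forall a, H3 _ _ (v a),
    forall a, cancel (u a) (v a) & forall a, cancel (v a) (u a)].
  by split=> a; have [] := svalP (projT2 (projT2 (Q a))).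
(* The arrow part [G'] also takes a proof that its argument is a morphism, so extensionality needs
   proof irrelevance. *)
have G'ext a b f g (hf : H2 a b f) (hg : H2 a b g) :
    f =1 g -> G' a b f hf =1 G' a b g hg.
  by move=> /funext fg x; subst g; rewrite (Prop_irrelevance hf hg).
have HT a b f hf : H3 _ _ (u a \o F' a b f hf \o v b).
  by apply: (comp3 _ _ _ _ _ (Hv b)); apply: (comp3 _ _ _ _ _ (FH _ _ _ hf)).
have T a b f hf : {g | exists hg : H2 (P a) (P b) g,
    G' _ _ g hg =1 u a \o F' a b f hf \o v b}.
  by apply: cid; exact: Gfull.
exists P, (fun a b f hf => sval (T a b f hf)).
split=> [a b f hf|]; first by have [] := svalP (T a b f hf).
split=> [a hf|].
  have [hg E] := svalP (T a a id hf); apply: (Gfaith _ _ _ _ hg (id2 _)) => x.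
  by rewrite E Gid /= Fid /= vK.
split=> [a b c f g hf hg hgf|].
  have [kf Ef] := svalP (T _ _ f hf); have [kg Eg] := svalP (T _ _ g hg).
  have [k E] := svalP (T _ _ (g \o f) hgf).
  apply: (Gfaith _ _ _ _ k (comp2 _ _ _ _ _ kf kg)) => x.
  by rewrite E (GC _ _ _ _ _ kf kg) /= Ef Eg /= uK (FC _ _ _ _ _ hf hg).
split=> [a b f g hf hg fg|].
  have [kf Ef] := svalP (T _ _ f hf); have [kg Eg] := svalP (T _ _ g hg).
  apply: (Ffaith _ _ _ _ hf hg) => x; apply: (can_inj (uK a)).
  have := G'ext _ _ _ _ kf kg fg (u b x).
  by rewrite Ef Eg /= uK.
split=> [a b h hh|d].
  have Hk : H3 _ _ (v a \o G' _ _ h hh \o u b).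
    by apply: (comp3 _ _ _ _ _ (Hu b)); apply: (comp3 _ _ _ _ _ (GH _ _ _ hh)).
  have [f [hf E]] := Ffull _ _ _ Hk; exists f, hf.
  have [k Ef] := svalP (T _ _ f hf).
  by apply: (Gfaith _ _ _ _ k hh) => x; rewrite Ef /= E /= !vK.
(* The isomorphisms joining [G d], [F c] and [G (P c)] compose, and fullness of [G'] lifts the
   composite and its inverse to arrows between [P c] and [d]. *)
have [c [s [t [Hs Ht sK tK]]]] := Fsurj (G d); exists c.
have [p [hp Ep]] := Gfull _ _ _ (comp3 _ _ _ _ _ Hs (Hu c)).
have [q [hq Eq]] := Gfull _ _ _ (comp3 _ _ _ _ _ (Hv c) Ht).
exists p, q; split=> //.
  apply: (Gfaith _ _ _ _ (comp2 _ _ _ _ _ hp hq) (id2 _)) => x.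
  by rewrite (GC _ _ _ _ _ hp hq) Gid /= Ep Eq /= tK vK.
apply: (Gfaith _ _ _ _ (comp2 _ _ _ _ _ hq hp) (id2 _)) => x.
by rewrite (GC _ _ _ _ _ hq hp) Gid /= Eq Ep /= uK sK.
Qed.

Lemma StKBSp_hom_id (X : skbSpace) : @StKBSp_hom X X id.
Proof. by split=> [x A|U []]. Qed.

Lemma StKBSp_hom_comp (X Y Z : skbSpace) (f : X -> Y) (g : Y -> Z) :
  StKBSp_hom f -> StKBSp_hom g -> StKBSp_hom (g \o f).
Proof.
move=> [cf hf] [cg hg]; split=> [x|U [cU oU]].
  by apply: continuous_comp; [exact: cf|exact: cg].
rewrite comp_preimage; apply: hf; split; first exact: hg.
exact: (proj1 (continuousP g) cg).
Qed.

Lemma AriFrm_hom_comp (L M N : ariFrame) (f : L -> M) (g : M -> N) :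
  AriFrm_hom f -> AriFrm_hom g -> AriFrm_hom (g \o f).
Proof.
move=> [[fT fI fS] fc] [[gT gI gS] gc]; split; last by move=> a /fc/gc.
split=> [|a b|S] /=; first by rewrite fT.
  by rewrite fI.
by rewrite fS gS image_comp.
Qed.

Theorem theorem5p5 :
  cat_equivalent AriLPries_car AriLPries_hom StKBSp_car StKBSp_hom /\
  cat_dually_equivalent AriLPries_car AriLPries_hom AriFrm_car AriFrm_hom.
Proof.
split; last exact: AriLPries_dually_equivalent_AriFrm.
apply: (cat_equivalent_of_dual StKBSp_hom_id StKBSp_hom_comp AriFrm_hom_comp).
  exact: AriLPries_dually_equivalent_AriFrm.
exact: StKBSp_dually_equivalent_AriFrm.
Qed.
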